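(* Let $m$, $n$, and $k$ be integers with $k\ge 1$ and $1\leq m\leq n-k$. If $f: St(n,k)\to\mathbb{R}^m$ is continuous, then the set $\{V\in St(n,k) : f(S(V))=f(V)\}$ is $S$-invariant and, with the restricted involution $S$, has Yang index at least $n-k-m$.
   Context: All homology is with $\mathbb{Z}_2$ coefficients. Stiefel manifold. $St(n,k)=\{(v_1,\ldots,v_k) : v_i\in\mathbb{R}^n,\ v_i\cdot v_j=\delta_{i,j}\}$, with the free involution $S(v_1,\ldots,v_k)=(v_1,\ldots,v_{k-1},-v_k)$. Yang index. A $T$-space is a pair $(X,T)$ with $X$ a compact Hausdorff space and $T$ a fixed-point free involution of $X$. It is simplicial if $X$ is a finite simplicial complex whose simplices are permuted by $T$. For simplicial $(X,T)$, an $m$-chain $c$ is $T$-invariant if $T(c)=c$, equivalently $c=d+T(d)$ for some $m$-chain $d$. Let $C_m(X,T)$ be the group of $T$-invariant $m$-chains; $\partial$ restricts to these, and $H_m(X,T)=Z_m(X,T)/B_m(X,T)$, where $Z_m(X,T)$ is the kernel of $\partial_m$ on $C_m(X,T)$ and $B_m(X,T)$ is the image of $C_{m+1}(X,T)$ under $\partial_{m+1}$. For $c=d+T(d)\in Z_0(X,T)$, the index $\nu(c)\in\mathbb{Z}_2$ is the parity of the number of vertices in $d$; for $c=d+T(d)\in Z_m(X,T)$ with $m\ge 1$, $\nu(c)=\nu(\partial d)$, inductively. This is independent of choices and gives a homomorphism $\nu:H_m(X,T)\to\mathbb{Z}_2$. For an arbitrary $T$-space, $H_m(X,T)$ and $\nu$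 are defined in the Čech manner, i.e. as the inverse limit over the nerves of finite $T$-invariant open covers all of whose members $U$ satisfy $U\cap T(U)=\emptyset$ ($H_m(X,T)$ is isomorphic to the $m$-th Čech homology group of $X/T$). The Yang index $\nu(X,T)$ is the largest integer $m$ such that $\nu(H_m(X,T))\neq\{0\}$ (so having Yang index at least some $r\ge 0$ entails being nonempty). *)

(* Defs.v *)
From HB Require Import structures.
From mathcomp Require Import all_boot all_order all_algebra finmap.

Set Implicit Arguments.
Unset Strict Implicit.
Unset Printing Implicit Defensive.

Import Order.TTheory GRing.Theory Num.Theory.

Local Open Scope ring_scope.

(** Invariant mod 2 homology of a finite simplicial complex [K] with vertices
    in the finite type [V] and a simplicial map [tau].  A chain is the function
    giving the coefficient of each simplex. *)
Section InvariantHomology.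
Variables (V : finType) (K : {set {set V}}) (tau : V -> V).

Definition chain (W : finType) := {ffun {set W} -> 'F_2}.

Definition is_chain (m : nat) (c : chain V) : bool :=
  [forall s : {set V}, (c s != 0) ==> (s \in K) && (#|s| == m.+1)].

(* The value at the empty set is forced to be 0 so that vertices have zero
   boundary (the homology is not augmented). *)
Definition bd (c : chain V) : chain V :=
  [ffun t : {set V} =>
     if #|t| == 0%N then 0
     else \sum_(s : {set V} | (t \subset s) && (#|s| == #|t|.+1)) c s].

(* Simplices on which [p] is not injective are sent to 0. *)
Definition push (W : finType) (p : V -> W) (c : chain V) : chain W :=
  [ffun t : {set W} =>
     \sum_(s : {set V} | (p @: s == t) && (#|s| == #|t|)) c s].

Definition inv_chains (m : nat) : {set chain V} :=
  [set c | is_chain m c && (push tau c == c)].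

Definition inv_cycles (m : nat) : {set chain V} :=
  [set c in inv_chains m | bd c == 0].

Definition inv_boundaries (m : nat) : {set chain V} :=
  [set bd c | c in inv_chains m.+1].

(* The elements of the quotient are the cosets, seen as sets of cycles. *)
Definition inv_homology (m : nat) : {set {set chain V}} :=
  equivalence_partition (fun z z' : chain V => z - z' \in inv_boundaries m)
    (inv_cycles m).

(* On invariant cycles, the value does not depend on the chain [d] picked. *)
Fixpoint nu (m : nat) (c : chain V) : 'F_2 :=
  if [pick d : chain V | is_chain m d && (c == d + push tau d)] is Some d then
    if m is m'.+1 then nu m' (bd d) else \sum_(v : V) d [set v]
  else 0.

End InvariantHomology.

From mathcomp Require Import all_classical all_reals all_analysis.
Import numFieldNormedType.Exports.

Local Open Scope classical_set_scope.
Local Open Scope ring_scope.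

Definition is_Tspace (X : topologicalType) (T : X -> X) : Prop :=
  [/\ compact [set: X], hausdorff_space X, continuous T,
      (forall x, T (T x) = x) & (forall x, T x <> x)].

Section CechYangIndex.
Variables (X : topologicalType) (T : X -> X).

Record Tcover := MkTcover {
  members :> {fset (set X)};
  Tcover_open : forall A, A \in members -> open A;
  Tcover_cover : \bigcup_(A in [set` members]) A = [set: X];
  Tcover_inv : forall A, A \in members -> T @` A \in members;
  Tcover_disj : forall A, A \in members -> A `&` T @` A = set0 }.

Definition Tcover_act (U : Tcover) (A : U) : U :=
  FSetSub (Tcover_inv (fsvalP A)).

Definition nerve (U : Tcover) : {set {set U}} :=
  finset (fun s : {set U} => (0 < #|s|)%N &&
    `[< (\bigcap_(A in [set` s]) (val A : set X)) !=set0 >]).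

(* The empty set may be a member of a cover but is never a vertex of the
   nerve, hence equivariance is only required on nonempty members. *)
Definition projection (U' U : Tcover) (p : U' -> U) : Prop :=
  (forall A : U', val A `<=` val (p A)) /\
  (forall A : U', val A !=set0 -> p (Tcover_act A) = Tcover_act (p A)).

(* Elements of the inverse limit of the invariant homology groups of nerves:
   [p] maps the class [h U'] to the class [h U] iff it maps the cycles of the
   former into the latter. *)
Definition cech_class (m : nat) (h : forall U : Tcover, {set chain U}) : Prop :=
  (forall U, h U \in inv_homology (nerve U) (@Tcover_act U) m) /\
  (forall (U' U : Tcover) (p : U' -> U), projection p ->
     forall z, z \in h U' -> push p z \in h U).

(* [nu] commutes with projections and is constant on homology classes, so its
   value on an element of the limit is read on any cover and any cycle. *)
Definition nu_nonzero (m : nat) : Prop :=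
  exists h, cech_class m h /\
    exists (U : Tcover) (z : chain U),
      z \in h U /\ nu (nerve U) (@Tcover_act U) m z != 0.

Definition is_yang_index (r : nat) : Prop :=
  [/\ is_Tspace T, nu_nonzero r & forall m, nu_nonzero m -> (m <= r)%N].

Definition yang_index_ge (r : nat) : Prop :=
  exists2 s, is_yang_index s & (r <= s)%N.

End CechYangIndex.

Lemma restr_subproof (X : Type) (T : X -> X) (Z : set X) (TZ : T @` Z = Z)
  (x : Z) : T (val x) \in Z.
Proof.
have TZx : (T @` Z) (T (val x)) by exists (val x) => //; exact: set_valP.
by apply/mem_set; rewrite TZ in TZx.
Qed.

Definition restr (X : Type) (T : X -> X) (Z : set X) (TZ : T @` Z = Z)
  (x : Z) : Z := exist _ (T (val x)) (restr_subproof TZ x).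

(** The frames [v_1, ..., v_k] are the rows of a [k x n] matrix. *)
Section Stiefel.
Variables (R : realType) (n k : nat).

Definition stiefel : set 'M[R]_(k, n) :=
  [set V : 'M[R]_(k, n) | forall i j, \sum_(l < n) V i l * V j l = (i == j)%:R].

Definition neg_last (V : 'M[R]_(k, n)) : 'M[R]_(k, n) :=
  \matrix_(i, j) if i.+1 == k then - V i j else V i j.

Lemma stiefel_inv_subproof (V : stiefel) : neg_last (val V) \in stiefel.
Proof.
pose e (i : 'I_k) : R := (-1) ^+ (i.+1 == k).
have eE i l : neg_last (val V) i l = e i * val V i l.
  by rewrite mxE /e; case: eqP => _; rewrite ?mulN1r ?mul1r.
apply/mem_set => i j; have /= VP := set_valP V.
under eq_bigr => l _ do rewrite !eE mulrACA.
rewrite -mulr_sumr VP; case: eqVneq => [->|_]; last by rewrite mulr0.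
by rewrite mulr1 -expr2 sqrr_sign.
Qed.

Definition stiefel_inv (V : stiefel) : stiefel :=
  exist _ (neg_last (val V)) (stiefel_inv_subproof V).

End Stiefel.

Arguments stiefel R n k : clear implicits.
Arguments stiefel_inv R n k V : clear implicits.

(* Main.v *)
(** Fixing the first [k - 1] vectors of the frame to be standard basis vectors
    embeds a sphere of dimension [n - k] equivariantly, the involution becoming
    the antipodal map; so it is enough to find invariant cycles near the zeros
    of the odd map [g x = f x - f (- x)] on that sphere.

    The sphere carries arbitrarily fine invariant [(n - k)]-cycles of index 1:
    by induction, [c' = d + T d] where [d] is a fine chain that contracts [c] to
    a pole one dimension up, so that [bd d = c].  Given a cover [U] of the
    coincidence set, label each vertex either by a member of [U] that is near
    it, or by a pair [(i, sign)] when [g_i] has that sign near the vertex.  The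
    labelling sends the fine cycle to an invariant cycle of index 1 whose
    simplices never contain both labels [(i, +)] and [(i, -)].  Such a pair is
    removed at the cost of one dimension: in [z = d + T d], let [d] collect the
    simplices that contain [(i, +)]; then [bd d] is an invariant cycle with the
    same index as [z] in which neither label occurs.  After [m] steps an
    invariant [(n - k - m)]-cycle of index 1 is left in the nerve of [U].

    These cycles are chosen independently for each cover; since two projections
    between covers are contiguous and homology groups of nerves are finite, an
    ultrafilter on the covers turns them into an element of the inverse limit. *)
From HB Require Import structures.
Require Import Defs.
From mathcomp Require Import all_boot all_order all_algebra finmap.
From mathcomp Require Import zify lra.

Set Implicit Arguments.
Unset Strict Implicit.
Unset Printing Implicit Defensive.

Import Order.TTheory GRing.Theory Num.Theory.

Local Open Scope ring_scope.

(** * Chains modulo 2 *)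

Section Chains.
Variables V W : finType.
Implicit Types (K : {set {set V}}) (c d : chain V) (s t : {set V}) (p : V -> W).

Definition simplex s : chain V := [ffun t => (t == s)%:R].

(** Additive extension of a map given on simplices. A coefficient in ['F_2] is read as the natural
    number 0 or 1; this is additive because twice any chain is 0. *)
Definition lin (phi : {set V} -> chain W) c : chain W :=
  \sum_s phi s *+ (c s : nat).

Lemma F2_cases (a : 'F_2) : a = (a != 0)%:R.
Proof. by case: a => [[|[|a]] ha]; apply/val_inj. Qed.

Lemma F2_addcc (a : 'F_2) : a + a = 0.
Proof. by case: a => [[|[|a]] ha]; apply/val_inj. Qed.

Lemma addcc (T : finType) (c : chain T) : c + c = 0.
Proof. by apply/ffunP => s; rewrite !ffunE F2_addcc. Qed.

Lemma oppc (T : finType) (c : chain T) : - c = c.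
Proof. by rewrite -[RHS]addr0 -(subrr c) addrA addcc sub0r. Qed.

Lemma addc_eq0 (T : finType) (a b : chain T) : (a + b == 0) = (a == b).
Proof. by rewrite -[in LHS](oppc b) subr_eq0. Qed.

Lemma addcK (T : finType) (a b : chain T) : a + b + b = a.
Proof. by rewrite -addrA addcc addr0. Qed.

Lemma lin_supp phi c : lin phi c = \sum_(s | c s != 0) phi s.
Proof.
rewrite /lin [RHS]big_mkcond; apply: eq_bigr => s _.
by rewrite [c s]F2_cases; case: (c s == 0).
Qed.

Fact lin_is_additive phi : zmod_morphism (lin phi).
Proof.
move=> c d; rewrite oppc /lin -sumrN -big_split; apply: eq_bigr => s _ /=.
rewrite !ffunE oppc [c s]F2_cases [d s]F2_cases.
by case: (c s == 0); case: (d s == 0);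
  rewrite ?addr0 ?add0r ?mulr0n //= addcc.
Qed.
HB.instance Definition _ phi :=
  GRing.isZmodMorphism.Build (chain V) (chain W) (lin phi) (lin_is_additive phi).

Lemma lin_simplex phi s : lin phi (simplex s) = phi s.
Proof.
rewrite lin_supp (bigD1 s) ?ffunE ?eqxx //= big1 ?addr0 // => t.
by rewrite ffunE => /andP[/[swap] /negPf ->]; rewrite eqxx.
Qed.

End Chains.

(** * Boundary and pushforward as chain maps *)

Section BoundaryAndPush.
Variables V W : finType.
Implicit Types (K : {set {set V}}) (c d : chain V) (s t : {set V}) (p : V -> W).

Lemma chain_sum c : c = \sum_(s | c s != 0) simplex s.
Proof.
apply/ffunP => t; rewrite sum_ffunE.
rewrite (eq_bigr (fun s => if t == s then 1 else 0)); last first.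
  by move=> s _; rewrite ffunE; case: eqP.
rewrite -big_mkcondr.
case: (eqVneq (c t) 0) => [c0|cn0].
  by rewrite big1 // => s /andP[/[swap] /eqP <-]; rewrite c0 eqxx.
rewrite (bigD1 t) ?cn0 ?eqxx //= big1 => [|s]; last first.
  by case/andP => [/andP[_ /eqP->]]; rewrite eqxx.
by rewrite addr0 [c t]F2_cases cn0.
Qed.

(** Reduces identities between additive maps to single simplices. Only simplices that occur in [c]
    are tested, so conditions on the support of [c] can be used. *)
Lemma eq_additive (Z : zmodType) (f g : {additive chain V -> Z}) c :
  (forall s, c s != 0 -> f (simplex s) = g (simplex s)) -> f c = g c.
Proof.
by move=> fg; rewrite [c]chain_sum !raddf_sum; apply: eq_bigr.
Qed.

Fact bd_is_additive : zmod_morphism (@bd V).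
Proof.
move=> c d; apply/ffunP => t; rewrite !ffunE; case: ifP => _; first by rewrite subr0.
by rewrite -sumrN -big_split; apply: eq_bigr => s _; rewrite !ffunE.
Qed.
HB.instance Definition _ :=
  GRing.isZmodMorphism.Build (chain V) (chain V) (@bd V) bd_is_additive.

Fact push_is_additive p : zmod_morphism (push p).
Proof.
move=> c d; apply/ffunP => t; rewrite !ffunE.
by rewrite -sumrN -big_split; apply: eq_bigr => s _; rewrite !ffunE.
Qed.
HB.instance Definition _ p :=
  GRing.isZmodMorphism.Build (chain V) (chain W) (push p) (push_is_additive p).

Lemma bd_simplex s :
  bd (simplex s) = if (1 < #|s|)%N then \sum_(v in s) simplex (s :\ v) else 0.
Proof.
apply/ffunP => t; rewrite ffunE.
have -> : \sum_(u : {set V} | (t \subset u) && (#|u| == #|t|.+1)) simplex s u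
    = ((t \subset s) && (#|s| == #|t|.+1))%:R :> 'F_2.
  under eq_bigr => u _ do rewrite ffunE.
  have [ts|ts] := boolP ((t \subset s) && (#|s| == #|t|.+1)).
    rewrite (bigD1 s) //= eqxx big1 ?addr0 // => u /andP[_ /negPf->//].
  by rewrite big1 // => u ut; case: eqP => // us; rewrite -us ut in ts.
have [s1|s1] := ltnP 1 #|s|; last first.
  rewrite ffunE; case: eqP => // t0; case: andP => // -[_ /eqP s2].
  by move: s1 t0; rewrite s2; case: #|t|.
have [t0|t0] := eqVneq #|t| 0%N.
  rewrite sum_ffunE big1 // => v vs; rewrite ffunE; case: eqP => // tE.
  by move: t0 s1; rewrite tE (cardsD1 v s) vs => ->.
rewrite sum_ffunE.
under eq_bigr => v _ do rewrite ffunE.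
case: andP => [[ts /eqP st]|nts].
  have /cards1P[v vE] : #|s :\: t| == 1%N.
    by rewrite cardsD (setIidPr ts) st subSnn.
  have vs : v \in s by apply: (fintype.subsetP (subsetDl s t)); rewrite vE set11.
  have tE : t = s :\ v by rewrite -vE setDDr setDv set0U (setIidPr ts).
  rewrite (bigD1 v) //= -tE eqxx big1 ?addr0 // => w /andP[ws wv].
  case: eqP => // tw; have : w \notin t by rewrite tw !inE eqxx.
  by rewrite tE !inE wv ws.
rewrite big1 // => v vs; case: eqP => // tE; case: nts.
by rewrite tE subsetDl [#|s|](cardsD1 v s) vs.
Qed.

Lemma push_simplex p s :
  push p (simplex s) = if #|p @: s| == #|s| then simplex (p @: s) else 0.
Proof.
apply/ffunP => t; rewrite ffunE.
under eq_bigr => u _ do rewrite ffunE.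
have -> : \sum_(u : {set V} | (p @: u == t) && (#|u| == #|t|)) (u == s)%:R
    = ((p @: s == t) && (#|s| == #|t|))%:R :> 'F_2.
  have [ts|ts] := boolP ((p @: s == t) && (#|s| == #|t|)).
    rewrite (bigD1 s) //= eqxx big1 ?addr0 // => u /andP[_ /negPf->//].
  by rewrite big1 // => u ut; case: eqP => // us; rewrite -us ut in ts.
have [<-|nst] := eqVneq (p @: s) t.
  by rewrite eq_sym; case: eqP; rewrite !ffunE ?eqxx.
by case: ifP; rewrite !ffunE // [t == _]eq_sym (negPf nst).
Qed.

End BoundaryAndPush.

(** Each unordered pair contributes twice, hence 0 modulo 2; [enum_rank] separates the two
    orders. *)
Lemma sum_sym0 (V W : finType) (A : {set V}) (F : V -> V -> chain W) :
  (forall v w, F v w = F w v) ->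
  \sum_(v in A) \sum_(w in A | w != v) F v w = 0.
Proof.
move=> Fsym.
have E : \sum_(v in A) \sum_(w in A | w != v) F v w =
  \sum_(v in A) \sum_(w in A | (enum_rank w < enum_rank v)%N) F v w +
  \sum_(v in A) \sum_(w in A | (enum_rank v < enum_rank w)%N) F v w.
  rewrite -big_split; apply: eq_bigr => v vA /=.
  rewrite (bigID (fun w => enum_rank w < enum_rank v)%N) /=.
  congr (_ + _); apply: eq_bigl => w; rewrite -andbA; congr (_ && _);
    rewrite -(inj_eq enum_rank_inj) -val_eqE; case: ltngtP => //.
rewrite {}E (exchange_big_dep (mem A)) /=; last by move=> v w _ /andP[].
rewrite -big_split big1 //= => v vA.
under eq_bigr => w _ do rewrite Fsym.
have -> : \sum_(i in A | (v \in A) && (enum_rank v < enum_rank i)%N) F v i =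
   \sum_(w in A | (enum_rank v < enum_rank w)%N) F v w by apply: eq_bigl => w; rewrite vA.
exact: addcc.
Qed.

Lemma bd_bd (V : finType) (c : chain V) : bd (bd c) = 0.
Proof.
apply: (@eq_additive _ _ (@bd V \o @bd V) \0) => s _ /=.
rewrite bd_simplex; case: ltnP => s1; last by rewrite raddf0.
rewrite raddf_sum /=.
rewrite -[RHS](@sum_sym0 V V s (fun v w => if (2 < #|s|)%N then simplex (s :\ v :\ w) else 0)).
  apply: eq_bigr => v vs; rewrite bd_simplex.
  have -> : (1 < #|s :\ v|)%N = (2 < #|s|)%N by rewrite (cardsD1 v s) vs.
  case: ifP => _; last by rewrite big1.
  by apply: eq_bigl => w; rewrite !inE andbC.
by move=> v w; case: ifP => // _; rewrite setDDl setUC -setDDl.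
Qed.

(** If [p] is injective on [s], the faces of [s] correspond to those of the image. If it identifies
    two vertices [v] and [w], the faces opposite to them have equal pushforwards, which cancel, and
    every other face still contains both and is sent to 0. *)
Lemma bd_push (V W : finType) (p : V -> W) (c : chain V) :
  bd (push p c) = push p (bd c).
Proof.
apply: (@eq_additive _ _ (@bd W \o push p) (push p \o @bd V)) => s _ /=.
rewrite push_simplex bd_simplex.
have [ps|nps] := boolP (#|p @: s| == #|s|).
  rewrite bd_simplex (eqP ps); case: ifP => s1; last by rewrite raddf0.
  have pinj : {in s &, injective p} by apply/imset_injP.
  rewrite big_imset //= raddf_sum; apply: eq_bigr => v vs /=.
  have sub : {in s :\ v &, injective p}.
    by apply: sub_in2 pinj => w; rewrite inE => /andP[].
  rewrite push_simplex (introT eqP (card_in_imset sub)); congr simplex.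
  apply/setP => w; apply/setD1P/imsetP => [[wv /imsetP[u us uE]]|[u /setD1P[uv us ->]]].
    by exists u => //; rewrite !inE us andbT; apply: contra wv => /eqP <-; rewrite uE.
  by split; [apply: contra uv => /eqP /pinj ->|apply: imset_f].
rewrite raddf0; case: ifP => s1; last by rewrite raddf0.
have /injectivePn /= : ~~ injectiveb (fun x : {v | v \in s} => p (val x)).
  apply: contra nps => /injectiveP pinj; apply/imset_injP => v w vs ws pvw.
  by have := pinj (exist _ v vs) (exist _ w ws) pvw; case.
case=> -[v vs] [[w ws]]; rewrite -val_eqE /= => vw pvw.
rewrite raddf_sum /= (bigD1 v) //= (bigD1 w) /=; last by rewrite ws eq_sym vw.
rewrite big1 ?addr0 => [|u /andP[/andP[us uv] uw]].
  rewrite !push_simplex.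
  have E : p @: (s :\ v) = p @: (s :\ w).
    have h a b : a \in s -> b != a -> b \in s -> p a = p b -> p @: (s :\ a) \subset p @: (s :\ b).
      move=> as_ ba bs pab; apply/fintype.subsetP => _ /imsetP[u /setD1P[ua us] ->].
      have [->|ub] := eqVneq u b; last by apply: imset_f; rewrite !inE ub us.
      by rewrite -pab; apply: imset_f; rewrite !inE eq_sym ba as_.
    by apply/eqP; rewrite eqEsubset !h // eq_sym.
  have cE : #|s :\ v| = #|s :\ w|.
    by have := cardsD1 v s; rewrite vs (cardsD1 w s) ws => -[].
  by rewrite E cE addcc.
rewrite push_simplex; case: ifP => // /imset_injP pinj; case/eqP: vw.
by apply: pinj; rewrite // !inE ?vs ?ws andbT eq_sym.
Qed.

Lemma push_comp (U V W : finType) (p : U -> V) (q : V -> W) (c : chain U) :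
  push q (push p c) = push (q \o p) c.
Proof.
apply: (@eq_additive _ _ (push q \o push p) (push (q \o p))) => s _ /=.
have E : (q \o p) @: s = q @: (p @: s) by rewrite imset_comp.
rewrite !push_simplex E; case: ifPn => [/eqP ps|ps]; first by rewrite push_simplex ps.
rewrite raddf0; case: eqP => // qs; case/negP: ps.
by rewrite eqn_leq leq_imset_card -qs leq_imset_card.
Qed.

Lemma eq_push (V W : finType) (p q : V -> W) (c : chain V) :
  (forall s v, c s != 0 -> v \in s -> p v = q v) -> push p c = push q c.
Proof.
move=> pq; apply: eq_additive => s cs /=; rewrite !push_simplex.
by have -> : p @: s = q @: s by apply: eq_in_imset => v; apply: pq cs.
Qed.

Lemma push_id (V : finType) (c : chain V) : push id c = c.
Proof.
by apply: (@eq_additive _ _ (push id) idfun) => s _ /=; rewrite push_simplex imset_id eqxx.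
Qed.

Section ChainSupport.
Variables (V : finType) (K : {set {set V}}).
Implicit Types (c d : chain V) (s t : {set V}).

Lemma is_chainP m c :
  reflect (forall s, c s != 0 -> s \in K /\ #|s| = m.+1) (is_chain K m c).
Proof.
apply: (iffP forallP) => [Kc s cs|Kc s].
  by have /implyP/(_ cs)/andP[sK /eqP] := Kc s.
by apply/implyP => /Kc[-> ->] /=.
Qed.

Lemma is_chain0 m : is_chain K m 0.
Proof. by apply/is_chainP => s; rewrite ffunE eqxx. Qed.

Lemma is_chainD m c d : is_chain K m c -> is_chain K m d -> is_chain K m (c + d).
Proof.
move=> /is_chainP Kc /is_chainP Kd; apply/is_chainP => s.
by rewrite !ffunE; have [->|/Kc//] := eqVneq (c s) 0; rewrite add0r; apply: Kd.
Qed.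

Lemma is_chain_sum m (I : Type) (r : seq I) (P : pred I) (F : I -> chain V) :
  (forall i, P i -> is_chain K m (F i)) -> is_chain K m (\sum_(i <- r | P i) F i).
Proof.
move=> KF; elim/big_ind: _ => //; first exact: is_chain0.
exact: is_chainD.
Qed.

Lemma is_chain_simplex m s : s \in K -> #|s| = m.+1 -> is_chain K m (simplex s).
Proof.
by move=> sK sm; apply/is_chainP => t; rewrite ffunE; case: (eqVneq t s) => // ->.
Qed.

End ChainSupport.
Arguments is_chainP {V K m c}.

Lemma is_chain_push (V W : finType) (K : {set {set V}}) (L : {set {set W}})
    (p : V -> W) m (c : chain V) :
  (forall s, s \in K -> p @: s \in L) ->
  is_chain K m c -> is_chain L m (push p c).
Proof.
move=> KL /is_chainP Kc; rewrite [c]chain_sum raddf_sum; apply: is_chain_sum => s /Kc[sK sm].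
rewrite /= push_simplex; case: eqP => ps; last exact: is_chain0.
by apply: is_chain_simplex; rewrite ?ps //; apply: KL.
Qed.

(** * The index of invariant cycles *)

Definition augmentation (V : finType) (c : chain V) : 'F_2 := \sum_v c [set v].

Fact augmentation_is_additive (V : finType) : zmod_morphism (@augmentation V).
Proof.
move=> c d; rewrite /augmentation -sumrN -big_split.
by apply: eq_bigr => v _; rewrite !ffunE.
Qed.
HB.instance Definition _ (V : finType) :=
  GRing.isZmodMorphism.Build (chain V) 'F_2 (@augmentation V)
    (@augmentation_is_additive V).

Lemma augmentation_simplex (V : finType) (s : {set V}) :
  augmentation (simplex s) = (#|s| == 1%N)%:R.
Proof.
rewrite /augmentation; under eq_bigr => v _ do rewrite ffunE.
have [/cards1P[v ->]|s1] := boolP (#|s| == 1%N).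
  rewrite (bigD1 v) //= eqxx big1 ?addr0 // => w wv.
  by rewrite (inj_eq set1_inj) (negPf wv).
by rewrite big1 // => v _; case: eqP => // sE; rewrite -sE cards1 in s1.
Qed.

Lemma augmentation_push (V W : finType) (K : {set {set V}}) (p : V -> W) (c : chain V) :
  is_chain K 0 c -> augmentation (push p c) = augmentation c.
Proof.
move=> /is_chainP Kc.
apply: (@eq_additive _ _ (@augmentation W \o push p) (@augmentation V)) => s /Kc[_ /eqP/cards1P[v ->]] /=.
by rewrite push_simplex imset_set1 !cards1 eqxx !augmentation_simplex !cards1.
Qed.

(** An edge has two endpoints. *)
Lemma augmentation_bd (V : finType) (K : {set {set V}}) (c : chain V) :
  is_chain K 1 c -> augmentation (bd c) = 0.
Proof.
move=> /is_chainP Kc.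
apply: (@eq_additive _ _ (@augmentation V \o @bd V) \0) => s /Kc[_ s2] /=.
rewrite bd_simplex s2 /= raddf_sum /=.
rewrite (eq_bigr (fun=> 1)) => [|v vs]; last first.
  by rewrite augmentation_simplex; have := cardsD1 v s; rewrite vs s2 add1n => -[<-].
by rewrite sumr_const s2; apply/val_inj.
Qed.

(** Combinatorial form of a simplicial space with free involution. The last condition, no simplex
    meets its own image in the orbit of a vertex, is stronger than having no invariant simplex; it
    is what nerves of covers with [Tcover_disj] satisfy. Vertices outside [K] may be fixed by
    [tau]. *)
Definition free_complex (V : finType) (K : {set {set V}}) (tau : V -> V) :=
  [/\ involutive tau,
      forall s, s \in K -> tau @: s \in K,
      forall s t : {set V}, s \in K -> t \subset s -> t != finset.set0 -> t \in K &
      forall (s : {set V}) v, s \in K -> v \in s -> tau v \notin s].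

Section InvariantChains.
Variables (V : finType) (K : {set {set V}}) (tau : V -> V).

Lemma inv_chainsP m c :
  reflect (is_chain K m c /\ push tau c = c) (c \in inv_chains K tau m).
Proof. by rewrite inE; apply: (iffP andP) => -[? /eqP]. Qed.

Lemma inv_cyclesP m c :
  reflect [/\ is_chain K m c, push tau c = c & bd c = 0] (c \in inv_cycles K tau m).
Proof.
rewrite inE; apply: (iffP andP) => [[/inv_chainsP[? ?] /eqP]|[? ? ->]] //.
by split=> //; apply/inv_chainsP.
Qed.

End InvariantChains.
Arguments inv_chainsP {V K tau m c}.
Arguments inv_cyclesP {V K tau m c}.

Section FreeComplex.
Variables (V : finType) (K : {set {set V}}) (tau : V -> V).
Hypothesis Kfree : free_complex K tau.
Implicit Types (c d e z : chain V) (s t : {set V}).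

Let tauK : involutive tau. Proof. by case: Kfree. Qed.
Let Ktau s : s \in K -> tau @: s \in K. Proof. by case: Kfree => _ h _ _; apply: h. Qed.
Let Ksub s t : s \in K -> t \subset s -> t != finset.set0 -> t \in K.
Proof. by case: Kfree => _ _ h _; apply: h. Qed.
Let Kdisj s v : s \in K -> v \in s -> tau v \notin s.
Proof. by case: Kfree => _ _ _; apply. Qed.

Lemma is_chain_bd m c : is_chain K m.+1 c -> is_chain K m (bd c).
Proof.
move=> /is_chainP Kc; rewrite [c]chain_sum raddf_sum; apply: is_chain_sum => s /Kc[sK sm].
rewrite /= bd_simplex sm /=; apply: is_chain_sum => v vs.
have vm : #|s :\ v| = m.+1 by move: sm; rewrite (cardsD1 v) vs => -[].
by apply: is_chain_simplex => //; apply: (Ksub sK); rewrite ?subsetDl // -card_gt0 vm.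
Qed.

Lemma imset_invK s : tau @: (tau @: s) = s.
Proof. by rewrite -imset_comp (eq_imset _ tauK) imset_id. Qed.

Lemma push_tauK c : push tau (push tau c) = c.
Proof. by rewrite push_comp (@eq_push _ _ _ id) ?push_id // => s v _ _ /=; apply: tauK. Qed.

Lemma push_tauE c s : push tau c s = c (tau @: s).
Proof.
rewrite ffunE (bigD1 (tau @: s)) /=; last first.
  by rewrite imset_invK eqxx card_imset ?eqxx; last exact: inv_inj tauK.
rewrite big1 ?addr0 // => t /andP[/andP[/eqP ts _] /negP[]].
by rewrite -ts imset_invK.
Qed.

Lemma is_chain_tau m c : is_chain K m c -> is_chain K m (push tau c).
Proof. exact: is_chain_push. Qed.

Lemma inv_chainsD m c d : c \in inv_chains K tau m -> d \in inv_chains K tau m ->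
  c + d \in inv_chains K tau m.
Proof.
move=> /inv_chainsP[Kc tc] /inv_chainsP[Kd td]; apply/inv_chainsP.
by rewrite raddfD /= tc td; split=> //; apply: is_chainD.
Qed.

Lemma inv_cyclesD m c d : c \in inv_cycles K tau m -> d \in inv_cycles K tau m ->
  c + d \in inv_cycles K tau m.
Proof.
move=> /inv_cyclesP[Kc tc bc] /inv_cyclesP[Kd td bd]; apply/inv_cyclesP.
by rewrite !raddfD /= tc td bc bd addr0; split=> //; apply: is_chainD.
Qed.

(** The predicate [sel] picks one simplex out of each orbit, and [d] is the restriction of [c] to
    the picked ones. The freedom in [sel] is what later allows vertices to be removed. *)
Lemma inv_split m c (sel : {set V} -> bool) :
    (forall s, s \in K -> s != finset.set0 -> sel (tau @: s) = ~~ sel s) ->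
    c \in inv_chains K tau m ->
  exists d, [/\ is_chain K m d, c = d + push tau d &
                forall s, d s != 0 -> c s != 0 /\ sel s].
Proof.
move=> selN /inv_chainsP[/is_chainP Kc tc].
pose d : chain V := [ffun s => if sel s then c s else 0].
have dP s : d s != 0 -> c s != 0 /\ sel s by rewrite ffunE; case: ifP; rewrite ?eqxx.
exists d; split=> //; first by apply/is_chainP => s /dP[/Kc].
apply/ffunP => s; rewrite [RHS]ffunE push_tauE !ffunE -push_tauE tc.
have [cs|/Kc[sK sm]] := eqVneq (c s) 0; first by rewrite cs !if_same addr0.
by rewrite selN -?card_gt0 ?sm //; case: (sel s); rewrite /= ?addr0 ?add0r.
Qed.

(** Default choice of one simplex per orbit. *)
Let base s : bool := (enum_rank s < enum_rank (tau @: s))%N.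

Let baseN s : s \in K -> s != finset.set0 -> base (tau @: s) = ~~ base s.
Proof.
move=> sK s0; rewrite /base imset_invK -leqNgt [RHS]leq_eqVlt.
have nts : tau @: s != s.
  apply: contraTneq sK => ts; apply/negP => sK.
  have [v vs] := set0Pn _ s0.
  by have := Kdisj sK vs; rewrite -ts imset_f.
by rewrite (inj_eq (@ord_inj _)) (inj_eq enum_rank_inj) (negPf nts).
Qed.

Lemma inv_splitT m c : c \in inv_chains K tau m ->
  exists2 d, is_chain K m d & c = d + push tau d.
Proof. by move=> /(inv_split baseN)[d [Kd cd _]]; exists d. Qed.

Lemma inv_chains_split m d : is_chain K m d -> d + push tau d \in inv_chains K tau m.
Proof.
move=> Kd; apply/inv_chainsP; split; first by apply: is_chainD => //; apply: is_chain_tau.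
by rewrite raddfD /= push_tauK addrC.
Qed.

Lemma bd_inv_chains m c : c \in inv_chains K tau m.+1 -> bd c \in inv_cycles K tau m.
Proof.
move=> /inv_chainsP[Kc tc]; apply/inv_cyclesP; split; rewrite ?bd_bd -?bd_push ?tc //.
exact: is_chain_bd.
Qed.

Lemma bd_half m d : is_chain K m.+1 d -> bd (d + push tau d) = 0 ->
  bd d \in inv_cycles K tau m.
Proof.
move=> Kd bd0; apply/inv_cyclesP; split; rewrite ?bd_bd //; first exact: is_chain_bd.
by apply/eqP; rewrite -bd_push -addc_eq0 addrC -raddfD /= bd0.
Qed.

(** Exposes the half [d] that [pick] selects in [nu]. Since [d] must exist unconditionally, it is
    the dummy 0 when [c] is not an invariant chain. *)
Lemma nu_pick m c : exists2 d,
  c \in inv_chains K tau m -> is_chain K m d /\ c = d + push tau d &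
  c \in inv_chains K tau m ->
  nu K tau m c = if m is m'.+1 then nu K tau m' (bd d) else augmentation d.
Proof.
have [cm|cm] := boolP (c \in inv_chains K tau m); last by exists 0.
have [d0 Kd0 cd0] := inv_splitT cm.
case: m Kd0 {cm} => [|m] Kd0 /=; (case: pickP => [d /andP[Kd /eqP cd]|/(_ d0)];
  [by exists d|by rewrite Kd0 {1}cd0 eqxx]).
Qed.

(* The three statements depend on each other through the recursion. *)
Let nu_spec m :
  [/\ forall d, is_chain K m d -> d + push tau d \in inv_cycles K tau m ->
        nu K tau m (d + push tau d) =
        if m is m'.+1 then nu K tau m' (bd d) else augmentation d,
      forall z z', z \in inv_cycles K tau m -> z' \in inv_cycles K tau m ->
        nu K tau m (z + z') = nu K tau m z + nu K tau m z' &
      forall e, e \in inv_chains K tau m.+1 -> nu K tau m (bd e) = 0].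
Proof.
elim: m => [|m [IHd IHD IHB]].
  have nu0 d : is_chain K 0 d -> d + push tau d \in inv_cycles K tau 0 ->
      nu K tau 0 (d + push tau d) = augmentation d.
    move=> Kd zd; have zd' := inv_chains_split Kd.
    have [d' /(_ zd')[Kd' dd'] ->//] := nu_pick 0 (d + push tau d).
    (* Two halves of the same chain differ by an invariant chain, which splits again as
       [g + push tau g] and so has even augmentation. *)
    have e_inv : d + d' \in inv_chains K tau 0.
      apply/inv_chainsP; split; first exact: is_chainD.
      by apply/eqP; rewrite raddfD /= -addc_eq0 addrC addrACA -dd' addcc.
    have [g Kg eg] := inv_splitT e_inv.
    apply/eqP; rewrite -subr_eq0 -raddfB /= oppc addrC eg raddfD /=.
    by rewrite (augmentation_push tau Kg) F2_addcc.
  split=> // [z z' zz zz'|e /[dup] einv /inv_splitT[g Kg eg]].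
    have /inv_cyclesP[Kz tz _] := zz; have /inv_cyclesP[Kz' tz' _] := zz'.
    have [d Kd zd] := inv_splitT (introT inv_chainsP (conj Kz tz)).
    have [d' Kd' zd'] := inv_splitT (introT inv_chainsP (conj Kz' tz')).
    have E : z + z' = (d + d') + push tau (d + d').
      by rewrite zd zd' raddfD /= addrACA.
    rewrite E nu0 -?E; [|exact: is_chainD|exact: inv_cyclesD].
    by rewrite zd zd' !nu0 -?zd -?zd' // raddfD.
  have be : bd e = bd g + push tau (bd g) by rewrite [in LHS]eg raddfD /= bd_push.
  rewrite be nu0 -?be ?(augmentation_bd Kg) ?(is_chain_bd Kg) //.
  exact: bd_inv_chains.
have nuS d : is_chain K m.+1 d -> d + push tau d \in inv_cycles K tau m.+1 ->
    nu K tau m.+1 (d + push tau d) = nu K tau m (bd d).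
  move=> Kd zd; have zd' := inv_chains_split Kd.
  have /inv_cyclesP[_ _ zd0] := zd.
  have [d' /(_ zd')[Kd' dd'] ->//] := nu_pick m.+1 (d + push tau d).
  have e_inv : d + d' \in inv_chains K tau m.+1.
    apply/inv_chainsP; split; first exact: is_chainD.
    by apply/eqP; rewrite raddfD /= -addc_eq0 addrC addrACA -dd' addcc.
  (* The correction is the boundary of an invariant chain, of index 0 by the induction hypothesis
     one dimension down. *)
  have -> : bd d' = bd d + bd (d + d') by rewrite raddfD /= addrA addcc add0r.
  by rewrite IHD ?(IHB _ e_inv) ?addr0 ?(bd_half Kd) ?bd_inv_chains.
split=> // [z z' zz zz'|e /[dup] einv /inv_splitT[g Kg eg]].
  have /inv_cyclesP[Kz tz bz] := zz; have /inv_cyclesP[Kz' tz' bz'] := zz'.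
  have [d Kd zd] := inv_splitT (introT inv_chainsP (conj Kz tz)).
  have [d' Kd' zd'] := inv_splitT (introT inv_chainsP (conj Kz' tz')).
  have E : z + z' = (d + d') + push tau (d + d').
    by rewrite zd zd' raddfD /= addrACA.
  rewrite E nuS -?E; [|exact: is_chainD|exact: inv_cyclesD].
  have -> : bd (d + d') = bd d + bd d' by rewrite raddfD.
  rewrite IHD; [|apply: (bd_half Kd)|apply: (bd_half Kd')]; rewrite -?zd -?zd' //.
  by rewrite [in RHS]zd [in RHS]zd' !nuS -?zd -?zd'.
(* Thus [bd g] is a half of [bd e]; its own boundary is 0, which has index 0 as the boundary of the
   zero chain. *)
have be : bd e = bd g + push tau (bd g) by rewrite [in LHS]eg raddfD /= bd_push.
rewrite be nuS -?be ?(is_chain_bd Kg) //; last exact: bd_inv_chains.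
rewrite bd_bd -[X in nu K tau m X](raddf0 (@bd V)) IHB //.
by apply/inv_chainsP; rewrite raddf0; split=> //; apply: is_chain0.
Qed.

Lemma nu_half0 d : is_chain K 0 d -> bd (d + push tau d) = 0 ->
  nu K tau 0 (d + push tau d) = augmentation d.
Proof.
move=> Kd zd; have [h _ _] := nu_spec 0; apply: h => //.
by apply/inv_cyclesP; have /inv_chainsP[] := inv_chains_split Kd.
Qed.

Lemma nu_halfS m d : is_chain K m.+1 d -> bd (d + push tau d) = 0 ->
  nu K tau m.+1 (d + push tau d) = nu K tau m (bd d).
Proof.
move=> Kd zd; have [h _ _] := nu_spec m.+1; apply: h => //.
by apply/inv_cyclesP; have /inv_chainsP[] := inv_chains_split Kd.
Qed.

Lemma nuD m z z' : z \in inv_cycles K tau m -> z' \in inv_cycles K tau m ->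
  nu K tau m (z + z') = nu K tau m z + nu K tau m z'.
Proof. by have [_ + _] := nu_spec m; apply. Qed.

Lemma nu_bd m e : e \in inv_chains K tau m.+1 -> nu K tau m (bd e) = 0.
Proof. by have [_ _ +] := nu_spec m; apply. Qed.

Lemma inv_cycles_split m z : z \in inv_cycles K tau m ->
  exists2 d, is_chain K m d & z = d + push tau d.
Proof. by move=> /inv_cyclesP[Kz tz _]; apply: inv_splitT; apply/inv_chainsP. Qed.

(** With [sel], the half [d] takes all simplices containing [v] and none containing [tau v]; orbits
    that avoid both are split by [base]. Faces of [d] then avoid [tau v], so [bd d] does, and as
    [bd d] is invariant it avoids [v] as well. *)
Lemma peel_vertex m z v :
    z \in inv_cycles K tau m.+1 ->
  exists2 z', z' \in inv_cycles [set s in K | (v \notin s) && (tau v \notin s)] tau m &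
    nu K tau m z' = nu K tau m.+1 z.
Proof.
move=> /inv_cyclesP[Kz tz bz].
pose sel s := (v \in s) || ((tau v \notin s) && base s).
have mem_tau s w : (w \in tau @: s) = (tau w \in s).
  by rewrite -{1}(tauK w) mem_imset //; apply: inv_inj.
have selN s : s \in K -> s != finset.set0 -> sel (tau @: s) = ~~ sel s.
  move=> sK s0; rewrite /sel !mem_tau tauK baseN //.
  have := Kdisj sK (v := v); have := Kdisj sK (v := tau v); rewrite tauK.
  case: (v \in s) => /=; case: (tau v \in s) => //= _.
  by move/(_ isT).
have [d [Kd zd dsel]] := inv_split selN (introT inv_chainsP (conj Kz tz)).
have zd0 : bd (d + push tau d) = 0 by rewrite -zd.
exists (bd d); last by rewrite zd nu_halfS.
have /inv_cyclesP[Kbd tbd _] := bd_half Kd zd0.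
have bdv s : v \in s -> tau v \in s -> bd d s = 0.
  move=> vs tvs; apply/eqP; apply: contraT => /(is_chainP Kbd)[sK _].
  by have := Kdisj sK vs; rewrite tvs.
suff bdt s : tau v \in s -> bd d s = 0.
  apply/inv_cyclesP; split; rewrite ?bd_bd //; apply/is_chainP => s bs.
  have [sK sm] := is_chainP Kbd s bs; split => //.
  rewrite inE sK /=; apply/andP; split; apply: contra bs => vs; last by rewrite bdt.
  by rewrite -tbd push_tauE bdt // mem_tau tauK.
move=> tvs; rewrite ffunE; case: eqP => // _; rewrite big1 // => t /andP[st _].
apply/eqP; apply: contraT => /[dup] dt /dsel[_]; rewrite /sel.
have [tK _] := is_chainP Kd t dt.
have tvt : tau v \in t by apply: (fintype.subsetP st).
by rewrite tvt orbF => vt; have := Kdisj tK vt; rewrite tvt.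
Qed.

End FreeComplex.

(** * Naturality of the index under equivariant simplicial maps *)

Section Simplicial.
Variables (V W : finType) (K : {set {set V}}) (L : {set {set W}}).
Variables (tau : V -> V) (sigma : W -> W).
Hypotheses (Kfree : free_complex K tau) (Lfree : free_complex L sigma).
Variable p : V -> W.
Hypothesis pKL : forall s, s \in K -> p @: s \in L.
Hypothesis ptau : forall s v, s \in K -> v \in s -> p (tau v) = sigma (p v).

Lemma push_equiv m c : is_chain K m c -> push sigma (push p c) = push p (push tau c).
Proof.
move=> /is_chainP Kc; rewrite !push_comp; apply: eq_push => s v /Kc[sK _] vs /=.
by rewrite (ptau sK vs).
Qed.

Lemma push_inv_chains m c : c \in inv_chains K tau m -> push p c \in inv_chains L sigma m.
Proof.
move=> /inv_chainsP[Kc tc]; apply/inv_chainsP.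
by rewrite (push_equiv Kc) tc; split=> //; apply: is_chain_push Kc.
Qed.

Lemma push_inv_cycles m c : c \in inv_cycles K tau m -> push p c \in inv_cycles L sigma m.
Proof.
move=> /inv_cyclesP[Kc tc bc]; apply/inv_cyclesP.
by rewrite (push_equiv Kc) tc bd_push bc raddf0; split=> //; apply: is_chain_push Kc.
Qed.

(** The pushforward of a half is a half of the pushforward, so both recursions descend in parallel
    to the augmentation, which [push] preserves. *)
Lemma nu_push m z : z \in inv_cycles K tau m -> nu L sigma m (push p z) = nu K tau m z.
Proof.
elim: m z => [|m IH] z /[dup] zz /[dup] /(inv_cycles_split Kfree)[d Kd zd] /inv_cyclesP[_ _ bz];
  have E : push p z = push p d + push sigma (push p d) by rewrite zd raddfD /= (push_equiv Kd).
all: have bE : bd (push p d + push sigma (push p d)) = 0 by rewrite -E bd_push bz raddf0.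
all: have Ld := is_chain_push pKL Kd.
  by rewrite E (nu_half0 Lfree) // [in RHS]zd (nu_half0 Kfree) -?zd // (augmentation_push p Kd).
rewrite E (nu_halfS Lfree) // [in RHS]zd (nu_halfS Kfree) -?zd // bd_push IH //.
by apply: (bd_half Kfree Kd); rewrite -zd.
Qed.

End Simplicial.

(** The inclusion is an equivariant simplicial map, and pushing along [id] does not change the
    chain. *)
Lemma nu_sub (V : finType) (K K' : {set {set V}}) (tau : V -> V) m (z : chain V) :
    free_complex K tau -> free_complex K' tau -> {subset K' <= K} ->
    z \in inv_cycles K' tau m ->
  nu K tau m z = nu K' tau m z.
Proof.
move=> Kfree Kfree' K'K zK'; rewrite -[in LHS](push_id z).
by apply: (nu_push Kfree' Kfree) => // s; rewrite imset_id; apply: K'K.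
Qed.

Lemma peel_vertices (V : finType) (tau : V -> V) (vs : seq V) m (K : {set {set V}}) (z : chain V) :
    free_complex K tau -> z \in inv_cycles K tau (size vs + m) ->
  exists K' z', [/\ free_complex K' tau, {subset K' <= K},
    forall (s : {set V}) v, s \in K' -> v \in vs -> v \notin s /\ tau v \notin s,
    z' \in inv_cycles K' tau m & nu K' tau m z' = nu K tau (size vs + m) z].
Proof.
elim: vs K z => [|v vs IH] K z Kfree; first by move=> zK; exists K, z; split.
move=> /(peel_vertex Kfree v)[z1 zK1 nu1]; have [tauK Kt Ks Kd] := Kfree.
pose K1 := [set s in K | (v \notin s) && (tau v \notin s)]; rewrite -/K1 in zK1.
have K1P (s : {set V}) : s \in K1 -> [/\ s \in K, v \notin s & tau v \notin s].
  by rewrite inE => /and3P[].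
have mem_tau (s : {set V}) w : (w \in tau @: s) = (tau w \in s).
  by rewrite -{1}(tauK w) mem_imset //; apply: inv_inj.
have K1free : free_complex K1 tau.
  split=> //.
  - by move=> s /K1P[sK vs' tvs]; rewrite inE Kt // !mem_tau tauK tvs vs'.
  - move=> s t /K1P[sK vs' tvs] ts t0; rewrite inE (Ks s) //=.
    by apply/andP; split; [apply: contra vs'|apply: contra tvs]; apply: (fintype.subsetP ts).
  - by move=> s w /K1P[sK _ _]; apply: Kd.
have K1K : {subset K1 <= K} by move=> s /K1P[].
have [K' [z' [K'free K'K1 K'vs z'K' nu']]] := IH K1 z1 K1free zK1.
exists K', z'; split=> //; first by move=> s /K'K1/K1K.
  move=> s w sK'; rewrite inE => /predU1P[->|]; last exact: K'vs.
  by have /K1P[] := K'K1 s sK'.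
by rewrite nu' -(nu_sub Kfree K1free) // nu1.
Qed.

(** * Chain homotopies *)

Lemma sum_telescope (V : finType) (P : nat -> chain V) n :
  \sum_(j < n) (P j + P j.+1) = P 0%N + P n.
Proof.
elim: n => [|n IH]; first by rewrite big_ord0 addcc.
by rewrite big_ord_recr /= IH addrA addcK.
Qed.

Section Homotopy.
Variables (V W : finType).
Implicit Types (A : pred V) (p q : V -> W) (c : chain V) (s : {set V}).

(** [V * bool] is the vertex set of a cylinder over [V]: [side A] lifts the vertices of [A] to the
    top, and [fold p q] maps the bottom by [p] and the top by [q]. *)
Let bottom (v : V) := (v, false).
Let side A (v : V) := (v, A v).
Let fold p q (x : V * bool) := if x.2 then q x.1 else p x.1.

(* On a simplex with a single vertex [v] in [A], the track of the homotopy
   moving [v] to the other end of [V * bool] is a single simplex. *)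
Let track A s : chain (V * bool)%type :=
  \sum_(v in s | A v) simplex ((v, true) |: bottom @: s).

Let bottom_inj : injective bottom. Proof. by move=> v w []. Qed.
Let side_inj A : injective (side A). Proof. by move=> v w []. Qed.

Let track_none A s : (forall v, v \in s -> ~~ A v) -> track A s = 0.
Proof. by move=> sA; rewrite /track big1 // => v /andP[/sA/negP]. Qed.

Let track_one A s v : v \in s -> A v -> (forall w, w \in s -> A w -> w = v) ->
  track A s = simplex ((v, true) |: bottom @: s).
Proof.
move=> vs Av sA; rewrite /track (bigD1 v) ?vs //= big1 ?addr0 // => w.
by case/andP => /andP[ws Aw]; rewrite (sA w) ?eqxx.
Qed.

(** If no vertex of [s] is in [A], both ends coincide and cancel. If [v] is the only one, dropping
    the top copy of [v] from the track leaves the bottom, dropping its bottom copy leaves the side,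
    and the other faces are the tracks of the faces of [s] through [v]. *)
Let bd_track A s : (forall v w, v \in s -> w \in s -> A v -> A w -> v = w) ->
  bd (track A s) + lin (track A) (bd (simplex s)) =
  simplex (bottom @: s) + simplex (side A @: s).
Proof.
move=> sA; have [/existsP[v /andP[vs Av]]|] := boolP [exists v, (v \in s) && A v]; last first.
  rewrite negb_exists => /forallP nA.
  have {}nA v : v \in s -> ~~ A v by move=> vs; have := nA v; rewrite vs.
  have -> : side A @: s = bottom @: s.
    by apply: eq_in_imset => v /nA; rewrite /side => /negPf->.
  rewrite addcc track_none // raddf0 add0r bd_simplex; case: ifP => _; last by rewrite raddf0.
  rewrite raddf_sum big1 // => v vs; rewrite /= lin_simplex track_none // => w.
  by case/setD1P => _ /nA.
have vT : (v, true) \notin bottom @: s by apply/imsetP => -[w].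
have sv w : w \in s -> A w -> w = v by move=> ws Aw; apply: sA.
rewrite (track_one vs) // (bd_simplex ((v, true) |: bottom @: s)) cardsU1 vT card_imset //.
have -> : (1 < true + #|s|)%N by rewrite (cardsD1 v) vs.
rewrite (bigD1 (v, true)) /=; last by rewrite setU11.
have -> : ((v, true) |: bottom @: s) :\ (v, true) = bottom @: s.
  by rewrite setU1K.
rewrite -addrA; congr (_ + _).
rewrite (eq_bigl (fun x => x \in bottom @: s)); last first.
  move=> x; rewrite in_setU1; case: eqVneq => [->|] /=; last by rewrite andbT.
  by rewrite (negPf vT).
rewrite big_imset //=; last by move=> x y _ _; apply: bottom_inj.
rewrite (bigD1 v) //= -addrA.
have -> : ((v, true) |: bottom @: s) :\ bottom v = side A @: s.
  apply/setP => -[w b]; rewrite !inE !xpair_eqE.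
  apply/andP/imsetP => [[wv /orP[/andP[/eqP-> /eqP->]|/imsetP[u us [wu bF]]]]|[u us [-> ->]]].
  - by exists v; rewrite /side ?Av.
  - move: wv; rewrite wu bF andbT => uv; exists u => //; rewrite /side.
    by case: (boolP (A u)) uv => // /(sv _ us)->; rewrite eqxx.
  - have [Au|nAu] := boolP (A u); first by rewrite (sv u us Au) eqxx.
    split; first by apply/nandP; left; apply: contraNneq nAu => ->.
    by rewrite andbF /=; apply/imsetP; exists u.
(* What remains are the faces that keep both copies of [v]; there are none when [s] is a single
   vertex. *)
rewrite -[RHS]addr0; congr (_ + _); rewrite bd_simplex; case: ltnP => s1; last first.
  rewrite raddf0 addr0 big1 // => w /andP[ws wv].
  have : (#|[set v; w]| <= #|s|)%N.
    by apply/subset_leq_card/fintype.subsetP => u /set2P[] ->.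
  by rewrite cards2 eq_sym wv => /leq_trans/(_ s1).
rewrite raddf_sum /= [X in _ + X](bigD1 v) //= lin_simplex track_none ?add0r; last first.
  by move=> w /setD1P[wv ws]; apply: contra wv => /(sv _ ws)->.
rewrite [X in _ + X](_ : _ = \sum_(w in s | w != v) simplex (((v, true) |: bottom @: s) :\ bottom w)).
  exact: addcc.
apply: eq_bigr => w /andP[ws wv]; rewrite lin_simplex (@track_one _ _ v) //; last 2 first.
- by rewrite !inE eq_sym wv.
- by move=> u /setD1P[_ us]; apply: sv.
congr simplex; apply/setP => -[u b]; rewrite !inE !xpair_eqE.
have memb (t : {set V}) : ((u, b) \in bottom @: t) = (u \in t) && ~~ b.
  by apply/imsetP/andP => [[x xt [-> ->]]|[ut /negPf->]] //; exists u.
by rewrite !memb !inE; case: b {memb} => /=; rewrite ?andbT ?andbF ?orbF.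
Qed.

(** One stage of a prism operator: the vertices in [A] move from [p] to [q]. It is a chain homotopy
    on chains whose simplices have at most one vertex in [A]. *)
Definition slide p q A c : chain W := push (fold p q) (lin (track A) c).

Fact slide_is_additive p q A : zmod_morphism (slide p q A).
Proof. by move=> c d; rewrite /slide !raddfB. Qed.
HB.instance Definition _ p q A :=
  GRing.isZmodMorphism.Build (chain V) (chain W) (slide p q A) (slide_is_additive p q A).

Lemma bd_slide p q A c :
    (forall s v w, c s != 0 -> v \in s -> w \in s -> A v -> A w -> v = w) ->
  bd (slide p q A c) + slide p q A (bd c) =
  push p c + push (fun v => if A v then q v else p v) c.
Proof.
move=> cA; rewrite /slide bd_push -raddfD.
rewrite (_ : bd (lin (track A) c) + lin (track A) (bd c) = push bottom c + push (side A) c).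
  by rewrite raddfD /= !push_comp.
have E (f1 f2 f3 f4 : {additive chain V -> chain (V * bool)%type}) :
    (forall s, c s != 0 -> f1 (simplex s) + f2 (simplex s) = f3 (simplex s) + f4 (simplex s)) ->
    f1 c + f2 c = f3 c + f4 c.
  move=> H; rewrite [c]chain_sum !raddf_sum -!big_split.
  by apply: eq_bigr => s /H.
apply: (E (@bd _ \o lin (track A)) (lin (track A) \o @bd _) (push bottom) (push (side A))).
move=> s cs /=; rewrite lin_simplex bd_track; last by move=> v w; apply: cA.
by rewrite !push_simplex !card_imset ?eqxx.
Qed.

(** The first hypothesis is contiguity of [p] and [q]: the images of a simplex under both maps
    together span a simplex. *)
Lemma is_chain_slide (K : {set {set V}}) (L : {set {set W}}) m p q A c :
    (forall s (t : {set W}), s \in K -> t != finset.set0 -> t \subset p @: s :|: q @: s -> t \in L) ->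
    is_chain K m c ->
  is_chain L m.+1 (slide p q A c).
Proof.
move=> KL /is_chainP Kc; rewrite [c]chain_sum raddf_sum; apply: is_chain_sum => s /Kc[sK sm].
rewrite /= /slide lin_simplex raddf_sum; apply: is_chain_sum => v /andP[vs Av] /=.
rewrite push_simplex; case: eqP => [E|_]; last exact: is_chain0.
have sE : #|(v, true) |: bottom @: s| = m.+2.
  by rewrite cardsU1 card_imset // sm (_ : _ \notin _) //; apply/imsetP => -[w].
apply: is_chain_simplex; rewrite ?E //; apply: (KL s) => //.
  by rewrite -card_gt0 E sE.
apply/fintype.subsetP => _ /imsetP[x /setU1P[->|/imsetP[w ws ->]] ->]; rewrite /fold /=.
  by apply/setUP; right; apply: imset_f.
by apply/setUP; left; apply: imset_f.
Qed.

Lemma push_slide (tau : V -> V) (sigma : W -> W) p q A c :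
    involutive tau -> (forall v, A (tau v) = A v) ->
    (forall s v, c s != 0 -> v \in s -> p (tau v) = sigma (p v)) ->
    (forall s v, c s != 0 -> v \in s -> q (tau v) = sigma (q v)) ->
  push sigma (slide p q A c) = slide p q A (push tau c).
Proof.
move=> tauK Atau ptau qtau.
apply: (@eq_additive _ _ (push sigma \o slide p q A) (slide p q A \o push tau)) => s cs /=.
have tinj : injective tau := inv_inj tauK.
rewrite push_simplex card_imset // eqxx /slide !lin_simplex push_comp /track.
rewrite (big_imset_cond _ _ (h := tau)) /=; last by move=> v w _ _; apply: tinj.
under [in RHS]eq_bigl => v do rewrite Atau.
rewrite !raddf_sum; apply: eq_bigr => v /andP[vs Av] /=.
(* The involution of the cylinder induced by [tau]; it carries tracks to tracks because [A] is
   invariant. *)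
pose T (x : V * bool) := (tau x.1, x.2).
have -> : (tau v, true) |: bottom @: (tau @: s) = T @: ((v, true) |: bottom @: s).
  by rewrite imsetU1 -!imset_comp.
have Tinj : injective T by move=> [x b] [y b'] [/tinj-> ->].
have -> : simplex (T @: ((v, true) |: bottom @: s)) = push T (simplex ((v, true) |: bottom @: s)).
  by rewrite push_simplex card_imset // eqxx.
rewrite push_comp; apply: eq_push => t x; rewrite ffunE; case: (eqVneq t ((v, true) |: bottom @: s)) => [-> _|_]; last by rewrite eqxx.
case/setU1P => [->|/imsetP[w ws ->]] /=; rewrite /fold /=.
  by rewrite (qtau s).
by rewrite (ptau s).
Qed.

(** Vertices move from [p] to [q] in the order of [r]: at stage [j] those of smaller rank have
    already moved. Vertices may share a rank as long as no simplex contains two of them, which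
    leaves room for an [r] that is constant on orbits. *)
Definition prism (r : V -> nat) n p q c : chain W :=
  \sum_(j < n) slide (fun v => if (r v < j)%N then q v else p v) q (fun v => r v == j) c.

Lemma bd_prism r n p q c :
    (forall v, r v < n)%N ->
    (forall s v w, c s != 0 -> v \in s -> w \in s -> r v = r w -> v = w) ->
    bd c = 0 ->
  bd (prism r n p q c) = push p c + push q c.
Proof.
move=> rn cr bc; pose P j := push (fun v => if (r v < j)%N then q v else p v) c.
rewrite /prism raddf_sum (eq_bigr (fun j : 'I_n => P j + P j.+1)); last first.
  (* The missing term of [bd_slide] is the slide of [bd c], which is 0 as [c] is a cycle. *)
  move=> j _ /=; rewrite -[LHS]addr0.
  rewrite -[X in _ + X](raddf0 (slide (fun v => if (r v < j)%N then q v else p v) q (fun v => r v == j))).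
  rewrite -bc bd_slide; last first.
    by move=> s v w cs vs ws /eqP rv /eqP rw; apply: (cr s); rewrite ?rv ?rw.
  congr (_ + _); apply: eq_push => s v _ _.
  have -> : (r v < j.+1)%N = (r v == j) || (r v < j)%N by rewrite ltnS [LHS]leq_eqVlt.
  by case: (r v == j).
have -> : push p c = P 0%N by apply: eq_push.
have -> : push q c = P n by apply: eq_push => s v _ _; rewrite rn.
exact: sum_telescope.
Qed.

Lemma is_chain_prism (K : {set {set V}}) (L : {set {set W}}) m r n p q c :
    (forall s (t : {set W}), s \in K -> t != finset.set0 -> t \subset p @: s :|: q @: s -> t \in L) ->
    is_chain K m c ->
  is_chain L m.+1 (prism r n p q c).
Proof.
move=> KL Kc; apply: is_chain_sum => j _; apply: is_chain_slide Kc => s t sK t0 ts.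
apply: (KL s) => //; apply: fintype.subset_trans ts _.
rewrite subUset subsetUr andbT; apply/fintype.subsetP => _ /imsetP[v vs ->].
by case: ifP => _; apply/setUP; [right|left]; apply: imset_f.
Qed.

Lemma push_prism (tau : V -> V) (sigma : W -> W) r n p q c :
    involutive tau -> (forall v, r (tau v) = r v) ->
    (forall s v, c s != 0 -> v \in s -> p (tau v) = sigma (p v)) ->
    (forall s v, c s != 0 -> v \in s -> q (tau v) = sigma (q v)) ->
  push sigma (prism r n p q c) = prism r n p q (push tau c).
Proof.
move=> tauK rtau ptau qtau; rewrite /prism raddf_sum; apply: eq_bigr => j _.
apply: push_slide => // [v|s v cs vs]; rewrite ?rtau //.
by case: ifP => _; [apply: (qtau s)|apply: (ptau s)].
Qed.

End Homotopy.

(** * Fine cycles on the boundary of the cube *)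

Section Grid.
Variables n a L : nat.

(** Lattice points of a cube with coordinates from 0 to [2L]. The centre has all coordinates [L], so
    [rev_ord] in each coordinate is the antipodal map. *)
Definition grid : finType := {ffun 'I_n -> 'I_L.*2.+1}.
Implicit Types (v w : grid) (s : {set grid}).

Definition grid_opp v : grid := [ffun j => rev_ord (v j)].

Definition on_edge v := [exists j, (v j == 0%N :> nat) || (v j == L.*2 :> nat)].

Definition in_slab i v := [forall j : 'I_n, ((j < a) || (a + i < j))%N ==> (v j == L :> nat)].

Definition grid_near i v w := [forall j, v j <= w j + i]%N.

(** A Rips-type complex: boundary points that vary only in the coordinates [a, ..., a + i], at
    mutual max-distance at most [i] ([grid_near] is one-sided, but both orders are tested). The mesh
    grows with the dimension because each contraction costs one unit. *)
Definition sphere i : {set {set grid}} :=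
  [set s : {set grid} | [&& s != finset.set0, [forall v in s, on_edge v && in_slab i v] &
      [forall v in s, forall w in s, grid_near i v w]]].

Lemma on_edgeP v :
  reflect (exists j : 'I_n, (v j = 0 :> nat) \/ (v j = L.*2 :> nat)) (on_edge v).
Proof.
by apply: (iffP existsP) => -[j vj]; exists j;
  [case/orP: vj => /eqP; [left|right]|apply/orP; case: vj => ->; [left|right]].
Qed.

Lemma in_slabP i v :
  reflect (forall j : 'I_n, (j < a)%N \/ (a + i < j)%N -> v j = L :> nat) (in_slab i v).
Proof.
apply: (iffP forallP) => vL j; first by move/orP; have /implyP/[apply]/eqP := vL j.
by apply/implyP => /orP/(vL j)/eqP.
Qed.

Lemma grid_nearP i v w : reflect (forall j : 'I_n, v j <= w j + i)%N (grid_near i v w).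
Proof. exact: forallP. Qed.

Lemma sphereP i s :
  reflect [/\ s != finset.set0, forall v, v \in s -> on_edge v /\ in_slab i v &
              forall v w, v \in s -> w \in s -> grid_near i v w] (s \in sphere i).
Proof.
rewrite inE; apply: (iffP and3P) => -[s0 sE sC]; split=> //.
- by move=> v vs; apply/andP; have /forallP/(_ v)/implyP := sE; apply.
- move=> v w vs ws; have /forallP/(_ v)/implyP/(_ vs) := sC.
  by move=> /forallP/(_ w)/implyP; apply.
- by apply/forallP => v; apply/implyP => /sE/andP.
- by apply/forallP => v; apply/implyP => vs; apply/forallP => w; apply/implyP; apply: sC.
Qed.

Lemma grid_oppK : involutive grid_opp.
Proof. by move=> v; apply/ffunP => j; rewrite !ffunE rev_ordK. Qed.

Lemma grid_oppE v j : grid_opp v j = (L.*2 - v j)%N :> nat.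
Proof. by rewrite ffunE /= subSS. Qed.

Lemma grid_le v j : (v j <= L.*2)%N.
Proof. by rewrite -ltnS. Qed.

(** In an extreme coordinate a point and its antipode differ by [2L], more than the mesh. *)
Lemma sphere_free i : (i < L.*2)%N -> free_complex (sphere i) grid_opp.
Proof.
move=> iL; split; first exact: grid_oppK.
- move=> s /sphereP[/set0Pn[v vs] sE sC]; apply/sphereP; split.
  + by apply/set0Pn; exists (grid_opp v); apply: imset_f.
  + move=> _ /imsetP[w ws ->]; have [/on_edgeP[j wj] /in_slabP wslab] := sE w ws; split.
      by apply/on_edgeP; exists j; rewrite !grid_oppE; have := grid_le w j; lia.
    by apply/in_slabP => l /wslab; rewrite grid_oppE; lia.
  + move=> _ _ /imsetP[w ws ->] /imsetP[u us ->]; apply/grid_nearP => j.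
    have /grid_nearP/(_ j) := sC u w us ws; rewrite !grid_oppE.
    by have := grid_le w j; have := grid_le u j; lia.
- move=> s t /sphereP[_ sE sC] ts t0; apply/sphereP; split=> //.
    by move=> v vt; apply: sE; apply: (fintype.subsetP ts).
  by move=> v w vt wt; apply: sC; apply: (fintype.subsetP ts).
- move=> s v /sphereP[_ sE sC] vs; apply/negP => ovs.
  have [/on_edgeP[j vj] _] := sE v vs.
  have /grid_nearP/(_ j) := sC v _ vs ovs; have /grid_nearP/(_ j) := sC _ v ovs vs.
  by rewrite grid_oppE; lia.
Qed.

(* The contraction of the cube boundary in the coordinates [a, ..., a + i] to
   the pole [2L] of the coordinate [b]: first raise [b], then shrink the rest. *)
Definition contract (b u : nat) v : grid :=
  [ffun j : 'I_n => inord (if j == b :> nat then L + minn u L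
     else maxn (L - (L.*2 - u)) (minn (L + (L.*2 - u)) (v j)))%N].

Lemma contractE b u v j : contract b u v j =
  (if j == b :> nat then L + minn u L
   else maxn (L - (L.*2 - u)) (minn (L + (L.*2 - u)) (v j)))%N :> nat.
Proof.
rewrite ffunE inordK //; case: ifP => _; first by lia.
by have := grid_le v j; lia.
Qed.

(** One time step moves each coordinate by at most 1, hence mesh [i + 1]. The points stay on the
    boundary: up to time [L] the extreme coordinate of [v] is untouched, and from time [L] on the
    raised coordinate equals [2L]. *)
Lemma sphere_contract i u s (t : {set grid}) :
    (0 < L)%N -> (a + i.+1 < n)%N -> (u < L.*2)%N -> s \in sphere i -> t != finset.set0 ->
    t \subset contract (a + i.+1) u @: s :|: contract (a + i.+1) u.+1 @: s ->
  t \in sphere i.+1.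
Proof.
move=> L0 bn uL /sphereP[_ sE sC] t0 /fintype.subsetP ts.
have tP w : w \in t -> exists2 v, v \in s & exists2 e, (e <= 1)%N & w = contract (a + i.+1) (u + e) v.
  move=> /ts/setUP[] /imsetP[v vs ->]; exists v => //.
    by exists 0%N; rewrite ?addn0.
  by exists 1%N; rewrite ?addn1.
apply/sphereP; split=> // [w /tP[v vs [e e1 ->]]|w w' /tP[v vs [e e1 ->]] /tP[v' vs' [e' e1' ->]]].
  have [/on_edgeP[j vj] /in_slabP vslab] := sE v vs; split; last first.
    apply/in_slabP => l lb; rewrite contractE vslab; last by lia.
    by case: eqP => lb2; lia.
  apply/on_edgeP; have [ub|ub] := leqP L (u + e).
    exists (Ordinal bn); rewrite !contractE /= eqxx. lia.
  have jb : (j == a + i.+1 :> nat) = false.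
    by apply/negP => /eqP jb; have := vslab j; lia.
  by exists j; rewrite !contractE jb; lia.
apply/grid_nearP => j; rewrite !contractE; have /grid_nearP/(_ j) := sC v v' vs vs'.
by case: ifP => _; lia.
Qed.

Lemma contract0 i s v : (a + i.+1 < n)%N -> s \in sphere i -> v \in s ->
  contract (a + i.+1) 0 v = v.
Proof.
move=> bn /sphereP[_ sE _] /sE[_ /in_slabP vslab]; apply/ffunP => j; apply/val_inj.
rewrite [LHS]contractE /=; have := grid_le v j.
case: eqP => jb; first by rewrite vslab; lia.
move: (nat_of_ord (v j)) => x; lia.
Qed.

Lemma contract_max b v w : contract b L.*2 v = contract b L.*2 w.
Proof.
apply/ffunP => j; apply/val_inj; rewrite /= !contractE; case: ifP => // _.
by move: (nat_of_ord (v j)) (nat_of_ord (w j)); lia.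
Qed.

(** The final map is constant: it makes simplices of positive dimension degenerate, and sends a
    0-chain to its augmentation times the pole. *)
Lemma push_contract_max (K : {set {set grid}}) b i c :
  is_chain K i c -> augmentation c = 0 -> push (contract b L.*2) c = 0.
Proof.
move=> Kc c0; apply/eqP; apply: contraT => /eqP.
have [v0 _|nov] := pickP (fun _ : grid => true); last first.
  case; apply: (@eq_additive _ _ (push (contract b L.*2)) \0) => s cs /=.
  have [_ sm] := is_chainP Kc s cs.
  have /set0Pn[v vs] : s != finset.set0 by rewrite -card_gt0 sm.
  by have := nov v.
case; case: i Kc => [|i] Kc; last first.
  apply: (@eq_additive _ _ (push (contract b L.*2)) \0) => s /(is_chainP Kc)[_ sm] /=.
  rewrite push_simplex; case: eqP => // E.
  have : contract b L.*2 @: s \subset [set contract b L.*2 v0].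
    by apply/fintype.subsetP => _ /imsetP[v _ ->]; rewrite inE; apply/eqP/contract_max.
  by move/subset_leq_card; rewrite E cards1 sm.
have -> : push (contract b L.*2) c = lin (fun=> simplex [set contract b L.*2 v0]) c.
  apply: (@eq_additive _ _ (push _) (lin _)) => s /(is_chainP Kc)[_ sm] /=.
  rewrite lin_simplex; have /cards1P[v ->] : #|s| == 1%N by rewrite sm.
  by rewrite push_simplex imset_set1 !cards1 eqxx (contract_max b v v0).
rewrite lin_supp sumr_const.
have : \sum_(s | c s != 0) 1 = 0 :> 'F_2.
  rewrite -[RHS]c0 [in RHS](chain_sum c) raddf_sum; apply: eq_bigr => s /(is_chainP Kc)[_ sm] /=.
  by rewrite augmentation_simplex sm.
rewrite sumr_const => /eqP; set k := #|_|.
rewrite -(dvdn_pcharf (pchar_Fp (isT : prime 2))) => /dvdnP[l ->].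
by rewrite mulnC mulrnA mulr2n addcc mul0rn.
Qed.

(** The prisms along the contraction telescope from the identity to the constant map, so [bd d = c];
    then [d] is a half of the new cycle and the index is inherited from [c]. *)
Lemma sphere_cycle i : (a + i < n)%N -> (i < L.*2)%N ->
  exists2 z, z \in inv_cycles (sphere i) grid_opp i & nu (sphere i) grid_opp i z = 1.
Proof.
elim: i => [|i IH] ain iL.
  have L0 : (0 < L)%N by lia.
  have free := sphere_free iL.
  (* In dimension 0 the cycle is the pole of the axis [a] plus its antipode; the half is one
     vertex. *)
  pose e : grid := [ffun j : 'I_n => inord (if j == a :> nat then L.*2 else L)].
  have eE j : e j = (if j == a :> nat then L.*2 else L) :> nat.
    by rewrite ffunE inordK //; case: ifP; lia.
  have eK : [set e] \in sphere 0.
    apply/sphereP; split; first by rewrite -card_gt0 cards1.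
      move=> _ /set1P ->; split; last by apply/in_slabP => j; rewrite eE; case: eqP; lia.
      rewrite addn0 in ain.
      by apply/on_edgeP; exists (Ordinal ain); rewrite !eE eqxx; right.
    by move=> _ _ /set1P -> /set1P ->; apply/grid_nearP => j; lia.
  have Kd : is_chain (sphere 0) 0 (simplex [set e]) by apply: is_chain_simplex; rewrite ?cards1.
  have bd0 : bd (simplex [set e] + push grid_opp (simplex [set e])) = 0.
    by rewrite raddfD /= bd_push bd_simplex cards1 /= raddf0 addr0.
  exists (simplex [set e] + push grid_opp (simplex [set e])).
    by apply/inv_cyclesP; have /inv_chainsP[] := inv_chains_split free Kd.
  by rewrite (nu_half0 free) // augmentation_simplex cards1.
have [||c zc nuc] := IH; try lia.
have free := sphere_free (ltnW iL); have freeS := sphere_free iL.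
have /inv_cyclesP[Kc tc bc] := zc.
pose G u := contract (a + i.+1) u.
(* The contraction is not equivariant, so any injective ranking of the vertices will do. *)
pose d := \sum_(u < L.*2) prism (fun v => enum_rank v : nat) #|{: grid}| (G u) (G u.+1) c.
have Kd : is_chain (sphere i.+1) i.+1 d.
  apply: is_chain_sum => u _; apply: is_chain_prism Kc => s t sK t0.
  by apply: sphere_contract => //; lia.
(* In dimension 0 this is the evenness of [g + push tau g]; in higher dimensions [c] has no vertices
   to count. *)
have c0 : augmentation c = 0.
  case: (i) Kc zc free => [|j] Kc zc' fr.
    have [g Kg ->] := inv_cycles_split fr zc'.
    by rewrite raddfD /= (augmentation_push grid_opp Kg) F2_addcc.
  apply: (@eq_additive _ _ (@augmentation _) \0) => s /(is_chainP Kc)[_ sm] /=.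
  by rewrite augmentation_simplex sm.
have bd_d : bd d = c.
  rewrite raddf_sum (eq_bigr (fun u : 'I_L.*2 => push (G u) c + push (G u.+1) c)).
    rewrite (sum_telescope (fun u => push (G u) c)) (push_contract_max _ Kc c0) addr0.
    rewrite (@eq_push _ _ _ id) ?push_id // => s v /(is_chainP Kc)[sK _] vs.
    exact: contract0 sK vs.
  by move=> u _ /=; apply: bd_prism => // s v w _ _ _ /ord_inj/enum_rank_inj.
have bd0 : bd (d + push grid_opp d) = 0.
  by rewrite raddfD /= bd_push bd_d tc addcc.
exists (d + push grid_opp d).
  by apply/inv_cyclesP; have /inv_chainsP[] := inv_chains_split freeS Kd.
have := @nu_push _ _ _ _ _ _ free freeS id _ _ _ _ zc.
rewrite push_id nuc (nu_halfS freeS) // bd_d; apply => // s; rewrite imset_id.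
move=> /sphereP[s0 sE sC]; apply/sphereP; split=> // [v /sE[vE /in_slabP vslab]|v w vs ws].
  by split=> //; apply/in_slabP => j jb; apply: vslab; lia.
by apply/grid_nearP => j; have /grid_nearP/(_ j) := sC v w vs ws; lia.
Qed.

End Grid.

From mathcomp Require Import all_classical all_reals all_analysis.
Import numFieldNormedType.Exports.

Local Open Scope classical_set_scope.
Local Open Scope ring_scope.

(** * Covers and the inverse limit *)

(** A value is chosen at the member of smaller rank in each orbit and transported to the other by
    [sigma]. At fixed points of [tau] equivariance cannot be guaranteed. *)
Lemma equivariant_choice (V : finType) (W : Type) (tau : V -> V) (sigma : W -> W)
    (Rel : V -> W -> Prop) :
    involutive tau -> involutive sigma ->
    (forall v w, Rel v w -> Rel (tau v) (sigma w)) ->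
    (forall v, exists w, Rel v w) ->
  exists p : V -> W, forall v, Rel v (p v) /\ (tau v <> v -> p (tau v) = sigma (p v)).
Proof.
move=> tauK sigmaK Rel_inv /(@choice V W Rel)[g gP].
pose p v := if (enum_rank (tau v) < enum_rank v)%N then sigma (g (tau v)) else g v.
exists p => v; split; first by rewrite /p; case: ifP => _ //; rewrite -[v in Rel v _]tauK; apply: Rel_inv.
move=> vn; rewrite /p tauK.
have : enum_rank (tau v) != enum_rank v :> nat.
  by apply/eqP => /ord_inj/enum_rank_inj.
by case: ltngtP => // _ _; rewrite sigmaK.
Qed.

Lemma compact_finite_cover (X : topologicalType) (N : X -> set X) :
    compact [set: X] -> (forall x, open (N x) /\ N x x) ->
  exists D : {fset X}, forall y, exists2 x, x \in D & N x y.
Proof.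
move=> /compact_near_coveringP Xc NP.
(* The filter of properties that hold for all sufficiently large finite sets of centres. *)
pose F : set_system {fset X} := [set S | exists D0, forall D, fsubset D0 D -> S D].
have FF : Filter F.
  split; first by exists fset0.
    move=> P Q [D PD] [E QE]; exists (D `|` E)%fset => G; rewrite fsubUset => /andP[DG EG].
    by split; [apply: PD|apply: QE].
  by move=> P Q PQ [D PD]; exists D => E /PD /PQ.
have [D XD] : F (fun D => [set: X] `<=` [set y | exists2 x, x \in D & N x y]).
  apply: (Xc _ F (fun D y => exists2 x, x \in D & N x y)) => x _.
  have [Nop Nx] := NP x.
  exists (N x, [set D : {fset X} | x \in D]) => /=.
    split; first exact: open_nbhs_nbhs.
    by exists [fset x]%fset => D; rewrite fsub1set.
  by move=> [y D] /= [Ny xD]; exists x.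
by exists D => y; apply: (XD D).
Qed.

Section Cech.
Variables (X : topologicalType) (T : X -> X).
Hypothesis XT : is_Tspace T.
Implicit Types (U : Tcover T).

Let TK : involutive T. Proof. by case: XT. Qed.

Let imageTK (A : set X) : T @` (T @` A) = A.
Proof. by rewrite image_comp (_ : T \o T = id) ?image_id //; apply/funext => x /=. Qed.

Let mem_imageT (A : set X) x : (T @` A) x <-> A (T x).
Proof. by split=> [[y Ay <-]|ATx]; [rewrite TK|exists (T x)]. Qed.

Lemma Tcover_actK U : involutive (@Tcover_act _ _ U).
Proof. by move=> A; apply/val_inj; rewrite /= imageTK. Qed.

Lemma Tcover_act_neq U (A : U) : val A !=set0 -> Tcover_act A <> A.
Proof.
move=> [x Ax] /(congr1 val)/= TA.
have : (val A `&` T @` val A) x by rewrite TA.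
by rewrite (Tcover_disj (fsvalP A)).
Qed.

Lemma nerveP U (s : {set U}) :
  reflect (s != finset.set0 /\ exists x, forall A, A \in s -> (val A : set X) x)
    (s \in nerve U).
Proof.
rewrite inE card_gt0; apply: (iffP andP) => -[s0].
  by move=> /asboolP[x sx]; split=> //; exists x => A; apply: sx.
by case=> x sx; split=> //; apply/asboolP; exists x => A; apply: sx.
Qed.

Lemma nerve_free U : free_complex (nerve U) (@Tcover_act _ _ U).
Proof.
split; first exact: Tcover_actK.
- move=> s /nerveP[/set0Pn[A As] [x sx]]; apply/nerveP; split.
    by apply/set0Pn; exists (Tcover_act A); apply: imset_f.
  by exists (T x) => _ /imsetP[B Bs ->] /=; exists x => //; apply: sx.
- move=> s t /nerveP[_ [x sx]] /fintype.subsetP ts t0; apply/nerveP; split=> //.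
  by exists x => A /ts; apply: sx.
- move=> s A /nerveP[_ [x sx]] As; apply/negP => TAs.
  have : (val A `&` T @` val A) x by split; [exact: sx|exact: (sx (Tcover_act A))].
  by rewrite (Tcover_disj (fsvalP A)).
Qed.

Section Projections.
Variables (U' U : Tcover T).

Lemma projection_simplicial (p : U' -> U) s :
  projection p -> s \in nerve U' -> p @: s \in nerve U.
Proof.
move=> [pS _] /nerveP[/set0Pn[A As] [x sx]]; apply/nerveP; split.
  by apply/set0Pn; exists (p A); apply: imset_f.
by exists x => _ /imsetP[B /sx Bx ->]; apply: pS.
Qed.

Lemma projection_equivariant (p : U' -> U) (s : {set U'}) A :
  projection p -> s \in nerve U' -> A \in s -> p (Tcover_act A) = Tcover_act (p A).
Proof. by move=> [_ pT] /nerveP[_ [x sx]] As; apply: pT; exists x; apply: sx. Qed.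

(* Two projections are contiguous, and a prism whose steps are numbered by
   orbits of vertices is equivariant. *)
Lemma projection_homologous (p q : U' -> U) m (z : chain U') :
    projection p -> projection q -> z \in inv_cycles (nerve U') (@Tcover_act _ _ U') m ->
  push p z - push q z \in inv_boundaries (nerve U) (@Tcover_act _ _ U) m.
Proof.
move=> pP qP /inv_cyclesP[Kz tz bz]; rewrite oppc.
pose r (A : U') := minn (enum_rank A) (enum_rank (Tcover_act A)).
have rT A : r (Tcover_act A) = r A by rewrite /r Tcover_actK minnC.
apply/imsetP; exists (prism r #|{: U'}| p q z).
  apply/inv_chainsP; split.
    apply: is_chain_prism Kz => s t sK t0 /fintype.subsetP ts; apply/nerveP; split=> //.
    have /nerveP[_ [x sx]] := sK; exists x => A /ts/setUP[] /imsetP[B Bs ->].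
      by apply: pP.1; apply: sx.
    by apply: qP.1; apply: sx.
  rewrite (push_prism (tau := @Tcover_act _ _ U')) ?tz //; first exact: Tcover_actK.
    by move=> s A /(is_chainP Kz)[sK _]; apply: projection_equivariant pP sK.
  by move=> s A /(is_chainP Kz)[sK _]; apply: projection_equivariant qP sK.
rewrite bd_prism // => [A|s A B /(is_chainP Kz)[sK _] As Bs rAB].
  exact: leq_ltn_trans (geq_minl _ _) (ltn_ord _).
(* Members of equal rank lie in one orbit, and a simplex never contains both members of an orbit. *)
have [_ _ _ disj] := nerve_free U'.
have nAB : Tcover_act A <> B by move=> E; have := disj s A sK As; rewrite E Bs.
have nBA : Tcover_act B <> A by move=> E; have := disj s B sK Bs; rewrite E As.
have nTT : Tcover_act A = Tcover_act B -> A = B by move/(inv_inj (@Tcover_actK U')).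
have rk (C D : U') : enum_rank C = enum_rank D :> nat -> C = D.
  by move/ord_inj/enum_rank_inj.
move: rAB; rewrite /r; case: leqP => _; case: leqP => _ /rk // E; by [case: nBA|case: nAB|apply: nTT].
Qed.

Definition refines := forall A : U', exists B : U, val A `<=` (val B : set X).

Lemma refines_projection : refines -> exists p : U' -> U, projection p.
Proof.
move=> ref.
have [p pP] := @equivariant_choice U' U (@Tcover_act _ _ U') (@Tcover_act _ _ U)
  (fun A B => val A `<=` (val B : set X)) (@Tcover_actK U') (@Tcover_actK U)
  (fun A B AB => @image_subset _ _ T _ _ AB) ref.
exists p; split=> A; first by case: (pP A).
by move/Tcover_act_neq; have [_] := pP A; apply.
Qed.

End Projections.

Lemma refines_trans U1 U2 U3 : refines U1 U2 -> refines U2 U3 -> refines U1 U3.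
Proof.
by move=> r12 r23 A; have [B AB] := r12 A; have [C BC] := r23 B; exists C; apply: subset_trans BC.
Qed.

Lemma projection_comp U1 U2 U3 (p : U1 -> U2) (q : U2 -> U3) :
  projection p -> projection q -> projection (q \o p).
Proof.
move=> [pS pT] [qS qT]; split=> A; first exact: subset_trans (pS A) (qS _).
by move=> A0; rewrite /= pT // qT //; apply: subset_nonempty (pS A) A0.
Qed.

Lemma common_refinement U1 U2 : exists U, refines U U1 /\ refines U U2.
Proof.
pose M : {fset set X} := [fset (A `&` B)%classic | A in members U1, B in members U2]%fset.
have MP C : C \in M -> exists A B, [/\ A \in members U1, B \in members U2 & C = A `&` B].
  by move=> /imfset2P[A /= AU [B /= BU ->]]; exists A, B.
have M_in A B : A \in members U1 -> B \in members U2 -> A `&` B \in M.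
  by move=> AU BU; apply/imfset2P; exists A => //; exists B.
have Mop A : A \in M -> open A.
  by move=> /MP[B [C [BU CU ->]]]; apply: openI; [apply: Tcover_open BU|apply: Tcover_open CU].
have Mcov : \bigcup_(A in [set` M]) A = [set: X].
  apply/seteqP; split=> // x _.
  have : [set: X] x by []. rewrite -{1}(Tcover_cover U1) => -[A AU Ax].
  have : [set: X] x by []. rewrite -{1}(Tcover_cover U2) => -[B BU Bx].
  by exists (A `&` B) => //; apply: M_in.
have Minv A : A \in M -> T @` A \in M.
  move=> /MP[B [C [BU CU ->]]].
  rewrite (_ : T @` (B `&` C) = T @` B `&` T @` C); first by apply: M_in; apply: Tcover_inv.
  apply/seteqP; split=> x [].
    by move=> y [By Cy] <-; split; apply: imageP.
  by move=> /mem_imageT Bx /mem_imageT Cx; apply/mem_imageT.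
have Mdisj A : A \in M -> A `&` T @` A = set0.
  move=> /MP[B [C [BU CU ->]]]; apply/seteqP; split=> // x [[Bx _] [y [By _] yx]].
  by rewrite -(Tcover_disj BU); split=> //; exists y.
exists (MkTcover Mop Mcov Minv Mdisj); split=> -[A AM] /=; have [B [C [BU CU AE]]] := MP A AM.
  by exists (FSetSub BU) => /=; rewrite AE; apply: subIsetl.
by exists (FSetSub CU) => /=; rewrite AE; apply: subIsetr.
Qed.

(** Given disjoint open [A] around [T x] and [B] around [x], the neighbourhood of [x] formed by the
    points of [B] mapped into [A] is disjoint from its image. Finitely many of these, with their
    images, form a cover. *)
Lemma Tcover_exists : inhabited (Tcover T).
Proof.
have [Xc Xh Tc _ Tfree] := XT.
have /choice[N NP] : forall x, exists A : set X, [/\ open A, A x & A `&` T @` A = set0].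
  move=> x; move: Xh; rewrite open_hausdorff => /(_ (T x) x).
  case=> [|[A B] /= [/set_mem ATx /set_mem Bx] [Aop Bop /eqP AB]]; first exact/eqP/Tfree.
  exists (B `&` T @^-1` A); split=> //.
    by apply: openI => //; apply: open_comp => // y _; apply: Tc.
  apply/seteqP; split=> // y [[By _] [w [_ Aw] wy]].
  have : (A `&` B) y by rewrite -wy; split=> //; rewrite wy.
  by rewrite AB.
have [|D Dcov] := compact_finite_cover (N := N) Xc.
  by move=> x; have [] := NP x.
pose M : {fset set X} := ([fset N x | x in D] `|` [fset (T @` N x)%classic | x in D])%fset.
have MP A : A \in M -> exists x, x \in D /\ (A = N x \/ A = T @` N x).
  by move=> /fsetUP[] /imfsetP[x /= xD ->]; exists x; auto.
have Top A : open A -> open (T @` A).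
  move=> Aop; rewrite (_ : T @` A = T @^-1` A); last by apply/seteqP; split=> x /mem_imageT.
  by apply: open_comp => // y _; apply: Tc.
have Mop A : A \in M -> open A.
  by move=> /MP[x [_ [->|->]]]; have [Nop _ _] := NP x => //; apply: Top.
have Mcov : \bigcup_(A in [set` M]) A = [set: X].
  apply/seteqP; split=> // x _; have [y yD Nyx] := Dcov x; exists (N y) => //=.
  by apply/fsetUP; left; apply/imfsetP; exists y.
have Minv A : A \in M -> T @` A \in M.
  move=> /MP[x [xD [->|->]]]; apply/fsetUP; [right|left]; apply/imfsetP; exists x => //.
have Mdisj A : A \in M -> A `&` T @` A = set0.
  by move=> /MP[x [xD [->|->]]]; have [_ _ NN] := NP x; rewrite ?imageTK // setIC.
by constructor; apply: MkTcover Mop Mcov Minv Mdisj.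
Qed.

Section HomologyClasses.
Variables (U : Tcover T) (m : nat).
Implicit Types (z : chain U).
Local Notation K := (nerve U).
Local Notation act := (@Tcover_act _ _ U).

(** Has literally the form of a block of [equivalence_partition]. *)
Definition homology_class z : {set chain U} :=
  [set z' in inv_cycles K act m | z - z' \in inv_boundaries K act m].

Lemma inv_homologyP h :
  reflect (exists2 z, z \in inv_cycles K act m & h = homology_class z)
    (h \in inv_homology K act m).
Proof. exact: imsetP. Qed.

Lemma inv_boundaries0 : 0 \in inv_boundaries K act m.
Proof.
apply/imsetP; exists 0; last by rewrite raddf0.
by apply/inv_chainsP; rewrite raddf0; split=> //; apply: is_chain0.
Qed.

Lemma inv_boundariesD z z' : z \in inv_boundaries K act m ->
  z' \in inv_boundaries K act m -> z + z' \in inv_boundaries K act m.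
Proof.
move=> /imsetP[e eK ->] /imsetP[e' eK' ->]; rewrite -raddfD.
by apply: imset_f; apply: inv_chainsD.
Qed.

Lemma homology_classP z z' :
  reflect (z' \in inv_cycles K act m /\ z + z' \in inv_boundaries K act m)
    (z' \in homology_class z).
Proof. by rewrite [z' \in homology_class z]finset.in_set oppc; apply: andP. Qed.

Lemma homology_class_refl z : z \in inv_cycles K act m -> z \in homology_class z.
Proof. by move=> zK; apply/homology_classP; rewrite addcc inv_boundaries0. Qed.

Lemma homology_class_eq z z' : z + z' \in inv_boundaries K act m ->
  homology_class z = homology_class z'.
Proof.
move=> zz'; apply/setP => w; apply/homology_classP/homology_classP => -[wK zw]; split=> //.
  by have := inv_boundariesD zz' zw; rewrite (addrC z) addrA addcK.
by have := inv_boundariesD zz' zw; rewrite addrA addcK.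
Qed.

Lemma nu_homologous z z' : z \in inv_cycles K act m -> z' \in homology_class z ->
  nu K act m z' = nu K act m z.
Proof.
move=> zK /homology_classP[zK' /imsetP[e eK zz']].
have -> : z' = z + bd e by rewrite -zz' addrA addcc add0r.
have eK' := bd_inv_chains (nerve_free U) eK.
by rewrite (nuD (nerve_free U)) // (nu_bd (nerve_free U)) // addr0.
Qed.

End HomologyClasses.
Arguments inv_homologyP {U m h}.

Section Pushforward.
Variables (U' U : Tcover T) (p : U' -> U).
Hypothesis pP : projection p.

Lemma push_cycles m z : z \in inv_cycles (nerve U') (@Tcover_act _ _ U') m ->
  push p z \in inv_cycles (nerve U) (@Tcover_act _ _ U) m.
Proof.
apply: push_inv_cycles => [s|s A]; first exact: projection_simplicial.
exact: projection_equivariant.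
Qed.

Lemma nu_projection m z : z \in inv_cycles (nerve U') (@Tcover_act _ _ U') m ->
  nu (nerve U) (@Tcover_act _ _ U) m (push p z) = nu (nerve U') (@Tcover_act _ _ U') m z.
Proof.
apply: nu_push; [exact: nerve_free|exact: nerve_free| |] => [s|s A].
  exact: projection_simplicial.
exact: projection_equivariant.
Qed.

Lemma push_homology_class m z z' : z' \in homology_class m z ->
  push p z' \in homology_class m (push p z).
Proof.
move=> /homology_classP[zK' /imsetP[e eK zz']]; apply/homology_classP; split.
  exact: push_cycles.
rewrite -raddfD /= zz' -bd_push; apply: imset_f.
apply: push_inv_chains eK => [s|s A]; first exact: projection_simplicial.
exact: projection_equivariant.
Qed.

End Pushforward.

(** Through a common refinement the index can be read on the fixed cover [U0], whose nerve has no
    simplex with more than [#|U0|] vertices. This bound is what makes a largest index exist. *)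
Lemma nu_nonzero_bound U0 m : nu_nonzero T m -> (m < #|{: U0}|)%N.
Proof.
move=> [h [[hH hp] [U [z [zh nuz]]]]].
have [U' [/refines_projection[p pP] /refines_projection[p0 p0P]]] := common_refinement U U0.
have [z' zK' hU'] := inv_homologyP (hH U').
have [w wK hU] := inv_homologyP (hH U).
have zh' : push p z' \in homology_class m w.
  by rewrite -hU; apply: hp => //; rewrite hU' homology_class_refl.
have nu0 : nu (nerve U0) (@Tcover_act _ _ U0) m (push p0 z') != 0.
  rewrite nu_projection // -(nu_projection pP zK') (nu_homologous wK zh').
  by rewrite -(nu_homologous wK (z' := z)) // -hU.
have /is_chainP Kz : is_chain (nerve U0) m (push p0 z').
  by have /inv_cyclesP[] := push_cycles p0P zK'.
have [s /Kz[_ <-]|z0] := pickP (fun s => push p0 z' s != 0); first exact: max_card.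
case/negP: nu0; have -> : push p0 z' = bd 0.
  by rewrite raddf0; apply/ffunP => s; have /negbFE/eqP-> := z0 s; rewrite ffunE.
rewrite (nu_bd (nerve_free U0)) //.
by apply/inv_chainsP; rewrite raddf0; split=> //; apply: is_chain0.
Qed.

(* The ultrafilter selects, coherently, the classes seen from arbitrarily fine
   covers; by finiteness of the homology groups it selects one for each cover. *)
Lemma nu_nonzero_exists m :
    (forall U, exists2 z, z \in inv_cycles (nerve U) (@Tcover_act _ _ U) m &
                 nu (nerve U) (@Tcover_act _ _ U) m z = 1) ->
  nu_nonzero T m.
Proof.
move=> zEx.
pose z U := sval (cid2 (zEx U)).
have zK U : z U \in inv_cycles (nerve U) (@Tcover_act _ _ U) m.
  by rewrite /z; case: cid2.
have nuz U : nu (nerve U) (@Tcover_act _ _ U) m (z U) = 1.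
  by rewrite /z; case: cid2.
(* The filter of properties shared by all sufficiently fine covers. *)
pose F : set_system (Tcover T) := [set S | exists U, forall U', refines U' U -> S U'].
have FF : ProperFilter F.
  split.
    by move=> [U /(_ U)]; apply=> A; exists A.
  split; first by have [U] := Tcover_exists; exists U.
    move=> P Q [U PU] [U' QU']; have [V [VU VU']] := common_refinement U U'.
    by exists V => W WV; split; [apply: PU|apply: QU']; apply: refines_trans WV _.
  by move=> P Q PQ [U PU]; exists U => V /PU /PQ.
have [G [GU FG]] := ultraFilterLemma FF.
pose good U (h : {set chain U}) := [set U' | refines U' U /\
  forall p : U' -> U, projection p -> homology_class m (push p (z U')) = h].
have sel U : exists h, G (good U h).
  apply: contrapT => nh.
  (* If no class were selected, the ultrafilter would contain all the complements and, there being
     finitely many [h], their intersection; but a refinement of [U] is good for the class of its own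
     projected cycle. *)
  have {}nh h : G (~` good U h).
    by have [Gh|//] := in_ultra_setVsetC (good U h) GU; case: nh; exists h.
  have : G [set U' | forall h, ~ good U h U'].
    exact: (@filter_forall _ _ (fun h => ~` good U h) G _ nh).
  have : G [set U' | refines U' U] by apply: FG; exists U.
  move=> GUr Gn; have [U' [Ur]] := filter_ex (filterI GUr Gn).
  have [p0 p0P] := refines_projection Ur.
  move=> /(_ (homology_class m (push p0 (z U')))); apply; split=> // p pP.
  apply: homology_class_eq; rewrite -[X in _ + X]oppc.
  exact: projection_homologous pP p0P (zK U').
pose h U := sval (cid (sel U)).
have hG U : G (good U (h U)).
  by rewrite /h; case: cid.
exists h; split; first split.
- move=> U; have [U' [/refines_projection[p pP] /(_ p pP) <-]] := filter_ex (hG U).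
  by apply/inv_homologyP; exists (push p (z U')) => //; apply: push_cycles.
- move=> U1 U0 q qP w wh.
  (* One cover [U'] computes both classes, along [p] for [U1] and along [q \o p] for [U0]. *)
  have [U' [[/refines_projection[p pP] /(_ p pP) h1] [_ h0]]] := filter_ex (filterI (hG U1) (hG U0)).
  have {}h0 := h0 _ (projection_comp pP qP).
  by rewrite -h0 -(push_comp p q); apply: push_homology_class => //; rewrite h1.
have [U] := Tcover_exists; exists U.
have [U' [/refines_projection[p pP] /(_ p pP) <-]] := filter_ex (hG U).
exists (push p (z U')); split; first by apply: homology_class_refl; apply: push_cycles.
by rewrite nu_projection // nuz.
Qed.

Lemma yang_index_ge_nu r : nu_nonzero T r -> yang_index_ge T r.
Proof.
move=> nur; have [U0] := Tcover_exists.
have exP : exists s, `[< nu_nonzero T s >] by exists r; apply/asboolP.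
have ubP s : `[< nu_nonzero T s >] -> (s <= #|{: U0}|)%N.
  by move/asboolP/(nu_nonzero_bound U0)/ltnW.
have [s /asboolP nus smax] := ex_maxnP exP ubP.
by exists s; [split=> // s' ns'|]; apply: smax; apply/asboolP.
Qed.

End Cech.

(** * The Stiefel manifold *)

Section SubspaceTopology.
Variables (X : topologicalType) (A : set X).

Lemma val_continuous : continuous (\val : A -> X).
Proof. exact: (@initial_continuous A X set_val). Qed.

Lemma continuous_set_type (Y : topologicalType) (g : Y -> A) x :
  continuous_at x (\val \o g : Y -> X) -> continuous_at x g.
Proof.
move=> gc B [B' [[C Cop <-] /= Cx] CB].
by apply: filterS CB _; apply: gc; apply: open_nbhs_nbhs.
Qed.

Lemma set_type_compact : compact A -> compact [set: A].
Proof.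
move=> Ac F FF _.
have FA : F (\val @^-1` A) by apply: filterE => x; exact: (set_valP x).
have [x [Ax xF]] := Ac (\val @ F) _ FA; exists (exist _ x (mem_set Ax)); split=> // P Q FP [Q' [[C Cop <-] /= Cx] CQ].
have FvP : F (\val @^-1` (\val @` P)) by apply: filterS FP => w Pw; exists w.
have [y [[w Pw <-] Cw]] := xF _ _ FvP (open_nbhs_nbhs (conj Cop Cx)).
by exists w; split=> //; apply: CQ.
Qed.

Lemma set_type_hausdorff : hausdorff_space X -> hausdorff_space A.
Proof.
move=> Xh x y xy; apply: val_inj; apply: Xh => P Q Px Qy.
have [w [Pw Qw]] := xy _ _ (val_continuous Px) (val_continuous Qy).
by exists (\val w).
Qed.

End SubspaceTopology.

Lemma continuous_mx (R : numFieldType) (X : topologicalType) (p q : nat)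
    (g : X -> 'M[R]_(p, q)) x :
  (forall i j, continuous_at x (fun y => g y i j)) -> continuous_at x g.
Proof.
move=> gc A [P Pg PA]; apply: filterS PA _ => /=.
apply: filter_forall => i; apply: filter_forall => j.
exact: gc.
Qed.

Lemma entry_continuous (R : numFieldType) (X : topologicalType) (p q : nat)
    (g : X -> 'M[R]_(p, q)) x i j :
  continuous_at x g -> continuous_at x (fun y => g y i j).
Proof.
move=> gc; apply: (@continuous_comp _ _ _ g (fun M : 'M[R]_(p, q) => M i j)) => //.
exact: coord_continuous.
Qed.

Lemma continuous_sum (R : numFieldType) (X : topologicalType) (I : Type) (r : seq I)
    (g : I -> X -> R) x :
  (forall i, continuous_at x (g i)) ->
  continuous_at x (fun y => \sum_(i <- r) g i y).
Proof.
move=> gc; elim: r => [|i r IH].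
  by under eq_fun => y do rewrite big_nil; exact: cvg_cst.
by under eq_fun => y do rewrite big_cons; apply: cvgD => //; apply: gc.
Qed.

Section StiefelTopology.
Variables (R : realType) (n k : nat).
Hypothesis k_ge1 : (1 <= k)%N.
Local Notation St := (stiefel R n k).
Local Notation S := (stiefel_inv R n k).

Lemma stiefel_closed : closed St.
Proof.
have -> : St = \bigcap_(ij in [set: 'I_k * 'I_k])
    ((fun V : 'M[R]_(k, n) => \sum_(l < n) V ij.1 l * V ij.2 l) @^-1` [set (ij.1 == ij.2)%:R]).
  by apply/seteqP; split=> [V VS [i j] _|V VS i j]; [apply: VS|apply: (VS (i, j))].
apply: closed_bigI => -[i j] _; apply: preimage_closed; last exact: closed_eq.
move=> V _; apply: continuous_sum => l.
by apply: continuousM; apply: coord_continuous.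
Qed.

(** Heine-Borel is applied to row vectors, through [vec_mx]. Each row has unit length, so all
    entries are bounded by 1. *)
Lemma stiefel_compact : compact St.
Proof.
have -> : St = vec_mx @` [set x : 'rV[R]_(k * n) | St (vec_mx x)].
  by apply/seteqP; split=> [V VS|_ [x xS <-]//]; exists (mxvec V); rewrite /= ?mxvecK.
have vc : continuous (vec_mx : 'rV[R]_(k * n) -> 'M[R]_(k, n)).
  move=> x; apply: continuous_mx => i j.
  under eq_fun => y do rewrite mxE.
  exact: coord_continuous.
apply: continuous_compact; first exact: continuous_subspaceT.
apply: bounded_closed_compact; last by apply: preimage_closed stiefel_closed.
exists 1; split; first exact: real1.
move=> M M1 x xS /=; rewrite /Num.norm /= mx_normrE; apply/bigmax_leP; split.
  by rewrite ltW // (lt_trans ltr01).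
move=> [i0 l] _ /=; rewrite (ord1 i0); apply: le_trans (ltW M1).
have [[i j] ->] : exists ij : 'I_k * 'I_n, l = mxvec_index ij.1 ij.2.
  by case/mxvec_indexP: l => i j; exists (i, j).
have := xS i i; rewrite eqxx (bigD1 j) //= !mxE => E.
have : 0 <= \sum_(l < n | l != j) vec_mx x i l * vec_mx x i l.
  by apply: sumr_ge0 => l1 _; rewrite -expr2 sqr_ge0.
by rewrite ler_norml => ?; apply/andP; split; nra.
Qed.

Lemma neg_lastK : involutive (@neg_last R n k).
Proof. by move=> V; apply/matrixP => i j; rewrite !mxE; case: (i.+1 == k); rewrite ?opprK. Qed.

Lemma stiefel_invK : involutive S.
Proof. by move=> V; apply: val_inj; rewrite /= neg_lastK. Qed.

Lemma stiefel_inv_free (V : St) : S V <> V.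
Proof.
move=> /(congr1 val) /= SV; have k0 : (k.-1 < k)%N by case: (k) k_ge1.
pose i := Ordinal k0; have ik : i.+1 == k by rewrite /= prednK.
have /(_ i i) := set_valP V; rewrite eqxx big1 => [/esym/eqP|l _]; first by rewrite oner_eq0.
have := congr1 (fun M : 'M[R]_(k, n) => M i l) SV; rewrite mxE ik => Vil.
have Vil0 : \val V i l = 0 by lra.
by rewrite Vil0 mul0r.
Qed.

Lemma neg_last_continuous : continuous (@neg_last R n k).
Proof.
move=> V; apply: continuous_mx => i j.
have [ik|ik] := boolP (i.+1 == k).
  rewrite (_ : (fun y => _) = (fun y : 'M[R]_(k, n) => - y i j)).
    by apply: continuousN; apply: coord_continuous.
  by apply/funext => y; rewrite mxE ik.
rewrite (_ : (fun y => _) = (fun y : 'M[R]_(k, n) => y i j)); first exact: coord_continuous.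
by apply/funext => y; rewrite mxE (negPf ik).
Qed.

Lemma stiefel_inv_continuous : continuous S.
Proof.
move=> V; apply: continuous_set_type.
apply: (@continuous_comp _ _ _ (\val : St -> _) (@neg_last R n k)).
  exact: val_continuous.
exact: neg_last_continuous.
Qed.

Section Coincidence.
Variables (m : nat) (f : St -> 'rV[R]_m).
Hypothesis f_cont : continuous f.
Let Z : set St := [set V : St | f (S V) = f V].

Lemma coincidence_inv : S @` Z = Z.
Proof.
apply/seteqP; split=> [_ [V ZV <-]|V ZV]; first by rewrite /Z /= stiefel_invK.
by exists (S V); rewrite /Z /= ?stiefel_invK.
Qed.

Lemma coincidence_closed : closed Z.
Proof.
have -> : Z = \bigcap_(j in [set: 'I_m])
    ((fun V : St => f (S V) ord0 j - f V ord0 j) @^-1` [set 0]).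
  apply/seteqP; split=> [V ZV j _|V VZ] /=; first by rewrite ZV subrr.
  by apply/rowP => j; apply/eqP; rewrite -subr_eq0; apply/eqP/(VZ j).
apply: closed_bigI => j _; apply: preimage_closed; last exact: closed_eq.
move=> V _; apply: continuousB; apply: entry_continuous; last exact: f_cont.
by apply: continuous_comp; [apply: stiefel_inv_continuous|apply: f_cont].
Qed.

Lemma coincidence_Tspace (SZ : S @` Z = Z) : is_Tspace (restr SZ).
Proof.
split.
- apply: set_type_compact.
  exact: (subclosed_compact coincidence_closed (set_type_compact stiefel_compact)).
- by do 2 apply: set_type_hausdorff; apply: norm_hausdorff.
- move=> V; apply: continuous_set_type.
  apply: (@continuous_comp _ _ _ (\val : Z -> St) S); first exact: val_continuous.
  exact: stiefel_inv_continuous.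
- by move=> V; apply: val_inj; rewrite /= stiefel_invK.
- by move=> V /(congr1 val); apply: stiefel_inv_free.
Qed.

End Coincidence.

End StiefelTopology.

(** Around a point with good radius [r], the radius [r / 2] serves all points within [r / 2];
    compactness makes it uniform. Everything is relative to [B] because the map to the Stiefel
    manifold is only controlled on the cube boundary. *)
Lemma lebesgue_number (R : realType) (X : pseudoMetricType R) (B : set X) (I : Type)
    (N : I -> set X) :
    compact B ->
    (forall x, B x -> exists i, exists2 r, 0 < r & forall y, B y -> ball x r y -> N i y) ->
  exists2 d : R, 0 < d & forall x, B x -> exists i, forall y, B y -> ball x d y -> N i y.
Proof.
move=> /compact_near_coveringP Bc BN.
pose P (d : R) x := exists i, forall y, B y -> ball x d y -> N i y.
have BP : \forall d \near (0 : R)^'+, B `<=` P d.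
  apply: Bc => x Bx; have [i [r r0 rN]] := BN x Bx.
  have r20 : 0 < r / 2 by rewrite divr_gt0.
  exists (ball x (r / 2), [set d : R | d < r / 2]) => /=.
    by split; [apply: nbhsx_ballx|apply: nbhs_right_lt].
  move=> [y d] /= [xy dr]; exists i => w Bw yw; apply: rN => //.
  by rewrite [r]splitr; apply: ball_triangle xy _; apply: le_ball yw; apply: ltW.
have [d [d0 dP]] := filter_ex (filterI (nbhs_right_gt (0 : R)) BP).
by exists d.
Qed.

Lemma continuous_div (R : numFieldType) (X : topologicalType) (g h : X -> R) x :
  continuous_at x g -> h x != 0 -> continuous_at x h ->
  continuous_at x (fun y => g y * (h y)^-1).
Proof. by move=> gc h0 hc; apply: cvgM => //; apply: cvgV. Qed.

(** * The cube boundary inside the Stiefel manifold *)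

Section Cube.
Variables (R : realType) (n k : nat).
Hypotheses (k_ge1 : (1 <= k)%N) (k_le : (k <= n)%N).
Local Notation St := (stiefel R n k).
Local Notation S := (stiefel_inv R n k).

(** The norm is the max norm: this is the boundary of a cube in the last [n - k + 1] coordinates, a
    sphere of dimension [n - k] orthogonal to the first [k - 1] basis vectors. *)
Definition cube : set 'rV[R]_n :=
  [set x : 'rV[R]_n | `|x| = 1 /\ forall j : 'I_n, (j < k.-1)%N -> x ord0 j = 0].

Lemma rV_norm1 (x : 'rV[R]_n) : (forall j, `|x ord0 j| <= 1) ->
  (exists j, `|x ord0 j| = 1) -> `|x| = 1.
Proof.
move=> x1 [j xj]; rewrite /Num.norm /= mx_normrE; apply/eqP; rewrite eq_le; apply/andP; split.
  by apply/bigmax_leP; split=> // -[i l] _ /=; rewrite (ord1 i).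
by apply/bigmax_geP; right; exists (ord0, j) => //=; rewrite xj.
Qed.

Lemma cube_compact : compact cube.
Proof.
apply: bounded_closed_compact.
  exists 1; split; first exact: real1.
  by move=> M M1 x [x1 _] /=; rewrite x1 ltW.
have -> : cube = [set x : 'rV[R]_n | `|x| = 1] `&`
    \bigcap_(j in [set j : 'I_n | (j < k.-1)%N]) [set x : 'rV[R]_n | x ord0 j = 0].
  by apply/seteqP; split=> x [x1 x0]; split=> // j; apply: x0.
apply: closedI.
  apply: (@preimage_closed _ _ (fun x : 'rV[R]_n => `|x|) [set 1]); last exact: closed_eq.
  by move=> x _; apply: norm_continuous.
apply: closed_bigI => j _.
apply: (@preimage_closed _ _ (fun x : 'rV[R]_n => x ord0 j) [set 0]); last exact: closed_eq.
by move=> x _; apply: coord_continuous.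
Qed.

Lemma cubeN x : cube x -> cube (- x).
Proof. by move=> [x1 x0]; split=> [|j /x0]; rewrite ?normrN // mxE => ->; rewrite oppr0. Qed.

Definition sq_norm (x : 'rV[R]_n) : R := \sum_j x ord0 j * x ord0 j.

(** A point of [cube] need not have Euclidean length 1, hence the rescaling of the last row. *)
Definition frame (x : 'rV[R]_n) : 'M[R]_(k, n) :=
  \matrix_(i, j) if i.+1 == k then x ord0 j * (Num.sqrt (sq_norm x))^-1
                 else (i == j :> nat)%:R.

Lemma sq_norm_gt0 x : cube x -> 0 < sq_norm x.
Proof.
move=> [x1 _]; rewrite lt_neqAle sumr_ge0 ?andbT => [|j _]; last by rewrite -expr2 sqr_ge0.
apply/negP => /eqP/esym/eqP; rewrite psumr_eq0 => [/allP x0|j _]; last by rewrite -expr2 sqr_ge0.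
have xE : x = 0.
  by apply/rowP => j; rewrite mxE; apply/eqP; have := x0 j (mem_index_enum j); rewrite mulf_eq0 orbb.
by move: x1; rewrite xE normr0 => /esym/eqP; rewrite oner_eq0.
Qed.

Lemma frame_stiefel x : cube x -> frame x \in St.
Proof.
move=> cx; have x0 := sq_norm_gt0 cx; apply/mem_set => i j.
have small (i1 : 'I_k) : (i1.+1 == k) = false -> (i1 < k.-1)%N.
  by move=> ik; have := ltn_ord i1; lia.
have neq (i1 j1 : 'I_k) : (i1.+1 == k) = false -> j1.+1 == k -> (i1 == j1) = false.
  by move=> ik jk; apply/eqP => ij; rewrite ij jk in ik.
have cross (i1 : 'I_k) : (i1.+1 == k) = false ->
    \sum_(l < n) (i1 == l :> nat)%:R * (x ord0 l * (Num.sqrt (sq_norm x))^-1) = 0.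
  move=> ik; rewrite big1 // => l _; case: eqP => il; last by rewrite mul0r.
  by rewrite cx.2 ?mul0r ?mulr0 // -il small.
under eq_bigr => l _ do rewrite !mxE.
case ik : (i.+1 == k); case jk : (j.+1 == k).
- have -> : i = j by apply: val_inj => /=; lia.
  rewrite eqxx (eq_bigr (fun l => x ord0 l * x ord0 l * (sq_norm x)^-1)) => [|l _].
    by rewrite -mulr_suml mulfV // gt_eqF.
  by rewrite mulrACA -invfM -[X in X^-1]expr2 sqr_sqrtr // ltW.
- by rewrite eq_sym neq //; under eq_bigr => l _ do rewrite mulrC; rewrite cross.
- by rewrite neq // cross.
- have il : (i < n)%N by apply: leq_trans k_le.
  rewrite (bigD1 (Ordinal il)) //= eqxx mul1r big1 ?addr0 => [|l li]; last first.
    by case: eqP => [E|_]; rewrite ?mul0r //; case/eqP: li; apply: val_inj.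
  by rewrite eq_sym.
Qed.

Lemma frame_continuous x : cube x -> continuous_at x frame.
Proof.
move=> cx; have x0 := sq_norm_gt0 cx; apply: continuous_mx => i j.
case ik : (i.+1 == k).
  rewrite (_ : (fun y => _) = (fun y : 'rV[R]_n => y ord0 j * (Num.sqrt (sq_norm y))^-1)); last first.
    by apply/funext => y; rewrite mxE ik.
  apply: (@continuous_div _ _ (fun y : 'rV[R]_n => y ord0 j) (fun y => Num.sqrt (sq_norm y))).
    exact: coord_continuous.
    by rewrite gt_eqF // sqrtr_gt0.
  apply: (@continuous_comp _ _ _ sq_norm (@Num.sqrt R)); last exact: sqrt_continuous.
  apply: continuous_sum => l.
  by apply: continuousM; apply: coord_continuous.
rewrite (_ : (fun y => _) = (fun=> (i == j :> nat)%:R)); first exact: cst_continuous.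
by apply/funext => y; rewrite mxE ik.
Qed.

Lemma frameN x : frame (- x) = neg_last (frame x).
Proof.
have sN : sq_norm (- x) = sq_norm x.
  by apply: eq_bigr => j _; rewrite !mxE mulrNN.
by apply/matrixP => i j; rewrite !mxE; case: (i.+1 == k); rewrite ?sN ?mulNr.
Qed.

Lemma cube_nonempty : cube !=set0.
Proof.
have n0 : (n.-1 < n)%N by case: (n) (leq_trans k_ge1 k_le).
exists (\row_j (j == Ordinal n0)%:R); split.
  apply: rV_norm1 => [j|]; last by exists (Ordinal n0); rewrite mxE eqxx normr1.
  by rewrite mxE normr_nat; case: (j == _); rewrite ?ler01.
by move=> j jk; rewrite mxE; case: eqP jk => // ->; rewrite /=; lia.
Qed.

(** [frame x] is orthonormal for [x] in [cube]; elsewhere [e] may take the default [V0], so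
    continuity is stated relative to [cube]. *)
Lemma stiefel_param : exists e : 'rV[R]_n -> St,
  [/\ forall x, cube x -> e (- x) = S (e x) &
      forall x A, cube x -> nbhs (e x) A ->
        exists2 r, 0 < r & forall y, cube y -> ball x r y -> A (e y)].
Proof.
have [x0 cx0] := cube_nonempty.
pose V0 : St := exist _ (frame x0) (frame_stiefel cx0).
pose e x : St := insubd V0 (frame x).
have eE x : cube x -> \val (e x) = frame x.
  by move=> cx; rewrite insubdK //; apply: frame_stiefel.
exists e; split=> [x cx|x A cx [A' [[C Cop <-] /= Cx] CA]].
  by apply: val_inj; rewrite eE ?frameN /= ?eE //; apply: cubeN.
have /nbhs_ballP[r r0 rC] : nbhs x (frame @^-1` C).
  by apply: (frame_continuous cx); apply: open_nbhs_nbhs; split=> //; rewrite -(eE x cx).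
exists r => // y cy xy; apply: CA; rewrite /= set_valE eE //; exact: rC.
Qed.

End Cube.

(** * Labelling the cube by a cover of the coincidence set *)

Lemma ballN (R : numFieldType) (V : normedModType R) (x y : V) (r : R) :
  ball x r y -> ball (- x) r (- y).
Proof. by rewrite -!ball_normE /ball_ /= -opprD normrN. Qed.

Section GridPoints.
Variables (R : realType) (n k L : nat).
Hypothesis L_gt0 : (0 < L)%N.
Local Notation grid := (grid n L).

Definition grid_point (v : grid) : 'rV[R]_n := \row_j (((v j)%:R - L%:R) / L%:R).

Let L0 : 0 < L%:R :> R. Proof. by rewrite ltr0n. Qed.

Lemma grid_point_opp v : grid_point (grid_opp v) = - grid_point v.
Proof.
have L2 : L.*2%:R = L%:R + L%:R :> R by rewrite -addnn natrD.
by apply/rowP => j; rewrite !mxE grid_oppE natrB ?grid_le // -mulNr L2; congr (_ / _); lra.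
Qed.

Lemma grid_point_cube i s v : s \in sphere n k.-1 L i -> v \in s -> cube k (grid_point v).
Proof.
move=> /sphereP[_ sE _] /sE[/on_edgeP[j vj] /in_slabP vslab]; split.
  apply: rV_norm1 => [l|].
    have vl : (v l)%:R <= L%:R + L%:R :> R by rewrite -natrD addnn ler_nat grid_le.
    have v0 : 0 <= (v l)%:R :> R by [].
    by rewrite mxE normrM normfV (gtr0_norm L0) ler_pdivrMr // mul1r ler_norml; lra.
  exists j; rewrite mxE; case: vj => ->.
    by rewrite sub0r mulNr divff ?gt_eqF // normrN1.
  by rewrite -addnn natrD addrK divff ?gt_eqF // normr1.
by move=> l lk; rewrite mxE vslab ?subrr ?mul0r //; left.
Qed.

Lemma grid_point_ball i v w (d : R) : i%:R < d * L%:R ->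
  grid_near i v w -> grid_near i w v -> ball (grid_point v) d (grid_point w).
Proof.
move=> id /grid_nearP vw /grid_nearP wv.
have d0 : 0 < d by rewrite -(pmulr_lgt0 _ L0); apply: le_lt_trans id.
split=> // i0 j; rewrite -ball_normE /ball_ /= !mxE -mulrBl normrM normfV (gtr0_norm L0).
rewrite ltr_pdivrMr // (le_lt_trans _ id) // ler_norml.
have := vw j; have := wv j; rewrite -!(ler_nat R) !natrD => ? ?.
by apply/andP; split; lra.
Qed.

End GridPoints.

(** * From the fine cycle on the cube boundary to a cycle in the nerve *)

Section Labels.
Variables (R : realType) (m n k : nat).
Hypotheses (k_ge1 : (1 <= k)%N) (m_ge1 : (1 <= m)%N) (m_le : (m <= n - k)%N).
Local Notation St := (stiefel R n k).
Local Notation S := (stiefel_inv R n k).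
Variable f : St -> 'rV[R]_m.
Hypothesis f_cont : continuous f.
Local Notation Z := [set V : St | f (S V) = f V].
Variable SZ : S @` Z = Z.
Let ZT : is_Tspace (restr SZ) := coincidence_Tspace k_ge1 f_cont SZ.
Variable U : Tcover (restr SZ).
Variable e : 'rV[R]_n -> St.
Local Notation cube := (@cube R n k).
Hypothesis eN : forall x, cube x -> e (- x) = S (e x).
Hypothesis e_near : forall x (A : set St), cube x -> nbhs (e x) A ->
  exists2 r, 0 < r & forall y, cube y -> ball x r y -> A (e y).

Let label : finType := (U + 'I_m * bool)%type.

Let opp_label (l : label) : label :=
  match l with inl A => inl (Tcover_act A) | inr (i, b) => inr (i, ~~ b) end.

Let gap (V : St) i : R := f V ord0 i - f (S V) ord0 i.

(* The sets [region (inl A)] extend the pullbacks of the members of the cover to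
   open sets of the cube boundary so that the nerve does not get larger. *)
Let region (l : label) : set 'rV[R]_n :=
  match l with
  | inl A => [set x | exists z r, [/\ cube z, Z (e z), ball z r x &
      forall y, cube y -> ball z (r + r) y -> Z (e y) ->
        ((\val : Z -> St) @` val A) (e y)]]
  | inr (i, b) => [set x | if b then 0 < gap (e x) i else gap (e x) i < 0]
  end.

Let opp_labelK : involutive opp_label.
Proof. by move=> [A|[i b]] /=; rewrite ?negbK // (Tcover_actK ZT). Qed.

Let gapN V i : gap (S V) i = - gap V i.
Proof. by rewrite /gap stiefel_invK opprB. Qed.

Let region_opp l x : cube x -> region l x -> region (opp_label l) (- x).
Proof.
move=> cx; case: l => [A|[i b]] /=; last first.
  by rewrite eN // gapN; case: b; rewrite /= ?oppr_lt0 ?oppr_gt0.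
move=> [z [r [cz Zz zx zA]]]; exists (- z), r; split; first exact: cubeN.
- by rewrite /= eN // stiefel_invK.
- exact: ballN.
move=> y cy zy Zy; have cy' := cubeN cy.
have [||w Aw we] := zA (- y) cy'.
- by have := ballN zy; rewrite opprK.
- by rewrite /= eN // stiefel_invK.
exists (restr SZ w); first by exists w.
by rewrite /= we eN // stiefel_invK.
Qed.

(** Over [Z], a member of the cover is the trace of an open set of the Stiefel manifold. Off [Z],
    some coordinate of [gap] is nonzero and keeps its sign nearby. *)
Let region_cover x : cube x ->
  exists l, exists2 r, 0 < r & forall y, cube y -> ball x r y -> region l y.
Proof.
move=> cx; have [Zx|nZx] := pselect (Z (e x)).
  pose w : Z := exist _ (e x) (mem_set Zx).
  have : [set: Z] w by [].
  rewrite -(Tcover_cover U) => -[A AU Aw].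
  have [A' [[C Cop CA'] /= A'w] A'A] : nbhs w A by apply: open_nbhs_nbhs; split=> //; apply: Tcover_open AU.
  have Cx : nbhs (e x) C by apply: open_nbhs_nbhs; split=> //; move: A'w; rewrite -CA'.
  have [r r0 rC] := e_near cx Cx.
  (* The radius is halved since [region] tests the ball of twice the radius. *)
  exists (inl (FSetSub AU)); exists (r / 2); first by rewrite divr_gt0.
  move=> y cy xy; exists x, (r / 2); split=> // y'; rewrite -splitr => cy' xy' Zy'.
  exists (exist _ (e y') (mem_set Zy')) => //=; apply: A'A; rewrite -CA'.
  exact: rC xy'.
have [i gi] : exists i, gap (e x) i != 0.
  apply: contrapT => ng; apply: nZx; apply/rowP => i; apply/eqP; rewrite eq_sym -subr_eq0.
  by apply: contrapT => gi; apply: ng; exists i; apply/negP.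
have gc : continuous_at (e x) (gap^~ i).
  apply: continuousB; apply: entry_continuous; first exact: f_cont.
  by apply: continuous_comp; [apply: stiefel_inv_continuous|apply: f_cont].
have [g0|g0] : gap (e x) i < 0 \/ 0 < gap (e x) i by apply/orP; rewrite -neq_lt.
  have g_near : nbhs (gap (e x) i) [set r : R | r < 0].
    by apply: open_nbhs_nbhs; split=> //; apply: open_lt.
  have [r r0 rg] := e_near cx (gc _ g_near).
  by exists (inr (i, false)), r.
have g_near : nbhs (gap (e x) i) [set r : R | 0 < r].
  by apply: open_nbhs_nbhs; split=> //; apply: open_gt.
have [r r0 rg] := e_near cx (gc _ g_near).
by exists (inr (i, true)), r.
Qed.

(* The centre with the smallest radius lies in all the members. *)
Let common_point (s : {set U}) x : s != finset.set0 ->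
  (forall A, A \in s -> region (inl A) x) -> exists w, forall A, A \in s -> (val A) w.
Proof.
move=> /set0Pn[A0 A0s] sx.
have zrP (A : U) : exists zr : 'rV[R]_n * R, A \in s ->
    [/\ cube zr.1, Z (e zr.1), ball zr.1 zr.2 x &
      forall y, cube y -> ball zr.1 (zr.2 + zr.2) y -> Z (e y) ->
        ((\val : Z -> St) @` val A) (e y)].
  have [As|nAs] := boolP (A \in s); last by exists (0, 0).
  by have [z [r zr]] := sx A As; exists (z, r).
have /choice[zr {}zrP] := zrP.
have [A1 A1s minA] := Order.TotalTheory.arg_minP (fun A => (zr A).2) A0s.
have [c1 Z1 x1 _] := zrP A1 A1s.
exists (exist _ (e (zr A1).1) (mem_set Z1)) => A As.
have [cA _ xA AP] := zrP A As.
have [|w Aw we] := AP (zr A1).1 c1 _ Z1.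
  (* Both centres are near [x], so their distance is below the sum of the radii, at most twice the
     radius for [A]. *)
  apply: ball_triangle xA _; apply: le_ball (minA A As) _ _; exact: ball_sym.
by rewrite (_ : exist _ _ _ = w) //; apply: val_inj; rewrite /= -we.
Qed.

Let label_complex : {set {set label}} :=
  [set s : {set label} | (s != finset.set0) &&
    `[< exists x, cube x /\ forall l, l \in s -> region l x >]].

Let label_complexP (s : {set label}) :
  reflect (s != finset.set0 /\ exists x, cube x /\ forall l, l \in s -> region l x)
    (s \in label_complex).
Proof.
by rewrite inE; apply: (iffP andP) => -[s0 /asboolP sx].
Qed.

Let label_free : free_complex label_complex opp_label.
Proof.
split=> //.
- move=> s /label_complexP[/set0Pn[l ls] [x [cx sx]]]; apply/label_complexP; split.
    by apply/set0Pn; exists (opp_label l); apply: imset_f.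
  exists (- x); split; first exact: cubeN.
  by move=> _ /imsetP[l1 l1s ->]; apply: region_opp => //; apply: sx.
- move=> s t /label_complexP[_ [x [cx sx]]] /fintype.subsetP ts t0.
  by apply/label_complexP; split=> //; exists x; split=> // l /ts/sx.
- move=> s l /label_complexP[_ [x [_ sx]]] ls; apply/negP => ols.
  case: l ls ols => [A|[i b]] ls ols; last first.
    by have := sx _ ls; have := sx _ ols; rewrite /region /=; case: b {ls ols} => /=; lra.
  have [|B|w wA] := @common_point [set A; Tcover_act A] x.
  + by apply/set0Pn; exists A; rewrite set21.
  + by case/set2P => ->; apply: sx.
  have : (val A `&` restr SZ @` val A) w.
    by split; [apply: wA; rewrite set21|apply: (wA (Tcover_act A)); rewrite set22].
  by rewrite (Tcover_disj (fsvalP A)).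
Qed.

Let label_cycle : exists2 z, z \in inv_cycles label_complex opp_label (n - k) &
  nu label_complex opp_label (n - k) z = 1.
Proof.
have [d d0 dP] := lebesgue_number (@cube_compact R n k) region_cover.
(* After rescaling, the mesh [N / L] must be below the Lebesgue number [d]; the summand [N] ensures
   [N < 2L], as [sphere_free] requires. *)
pose N := (n - k)%N; pose L := (N + Num.bound (N%:R / d)).+1.
have NL : N%:R < d * L%:R.
  have Nd : 0 <= N%:R / d by rewrite divr_ge0 // ltW.
  rewrite mulrC -ltr_pdivrMr //; apply: lt_le_trans (archi_boundP Nd) _.
  by rewrite ler_nat /L; lia.
have [||z zK nuz] := @sphere_cycle n k.-1 L N; [by lia|by lia|].
have gfree : free_complex (sphere n k.-1 L N) (@grid_opp n L) by apply: sphere_free; lia.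
pose pt := @grid_point R n L.
have [||p pP] := @equivariant_choice (grid n L) label (@grid_opp n L) opp_label
  (fun v l => cube (pt v) -> forall y, cube y -> ball (pt v) d y -> region l y)
  (@grid_oppK n L) opp_labelK.
- move=> v l vl; rewrite /pt grid_point_opp // -/(pt v) => cv y cy vy.
  rewrite -[y]opprK; apply: region_opp; first exact: cubeN.
  apply: vl; last by have := ballN vy; rewrite opprK.
    by have := cubeN cv; rewrite opprK.
  exact: cubeN.
(* Grid points off the cube boundary get an arbitrary label. *)
- move=> v; have [cv|ncv] := pselect (cube (pt v)); last by exists (inr (Ordinal m_ge1, true)).
  by have [l lP] := dP _ cv; exists l.
have pS (s : {set grid n L}) : s \in sphere n k.-1 L N -> p @: s \in label_complex.
  move=> sK; have /sphereP[/set0Pn[v0 v0s] _ sC] := sK; apply/label_complexP; split.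
    by apply/set0Pn; exists (p v0); apply: imset_f.
  exists (pt v0); split; first exact: grid_point_cube sK v0s.
  move=> _ /imsetP[v vs ->]; have [+ _] := pP v; apply.
  - exact: grid_point_cube sK vs.
  - exact: grid_point_cube sK v0s.
  - by apply: grid_point_ball NL _ _ => //; apply: sC.
have pE (s : {set grid n L}) v : s \in sphere n k.-1 L N -> v \in s -> p (grid_opp v) = opp_label (p v).
  move=> sK vs; have [_ +] := pP v; apply => vv.
  by have [_ _ _ /(_ s v sK vs)] := gfree; rewrite vv vs.
exists (push p z); first exact: push_inv_cycles pS pE _ _ zK.
by rewrite (nu_push gfree label_free pS pE).
Qed.

Lemma nerve_cycle : exists2 z, z \in inv_cycles (nerve U) (@Tcover_act _ _ U) (n - k - m) &
  nu (nerve U) (@Tcover_act _ _ U) (n - k - m) z = 1.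
Proof.
have [z zK nuz] := label_cycle.
(* Only positive labels are listed: peeling a vertex also removes its opposite. *)
pose vs : seq label := [seq inr (i, true) | i <- enum 'I_m].
have vsm : size vs = m by rewrite size_map size_enum_ord.
have nkE : (n - k)%N = (size vs + (n - k - m))%N by rewrite vsm subnKC.
rewrite nkE in zK nuz.
have [K' [z' [K'free K'K K'vs z'K' nuz']]] := peel_vertices label_free zK.
have K'inl (s : {set label}) l : s \in K' -> l \in s -> exists A, l = inl A.
  move=> sK' ls; case: l ls => [A|[i b]] ls; first by exists A.
  have iv : inr (i, true) \in vs by apply: map_f; rewrite mem_enum.
  by have [+ +] := K'vs s _ sK' iv; case: b ls => /= ->.
(* A default value for [q] on the sign labels; some member exists since a cycle of index 1 is not
   zero. *)
have [A0 _] : exists A : U, true.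
  have /is_chainP Kz' : is_chain K' (n - k - m) z' by have /inv_cyclesP[] := z'K'.
  have [s /Kz'[sK' sm]|z0] := pickP (fun s => z' s != 0).
    have /set0Pn[l ls] : s != finset.set0 by rewrite -card_gt0 sm.
    by have [A _] := K'inl s l sK' ls; exists A.
  have : nu K' opp_label (n - k - m) z' != 0 by rewrite nuz' nuz.
  have -> : z' = bd 0.
    by rewrite raddf0; apply/ffunP => s; have /negbFE/eqP-> := z0 s; rewrite ffunE.
  rewrite (nu_bd K'free) //.
  by apply/inv_chainsP; rewrite raddf0; split=> //; apply: is_chain0.
pose q (l : label) : U := if l is inl A then A else A0.
have qS (s : {set label}) : s \in K' -> q @: s \in nerve U.
  move=> sK'; have /label_complexP[/set0Pn[l ls] [x [cx sx]]] := K'K s sK'.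
  have q0 : q @: s != finset.set0 by apply/set0Pn; exists (q l); apply: imset_f.
  apply/nerveP; split=> //; apply: (@common_point _ x q0) => _ /imsetP[l1 l1s ->].
  by have [A lA] := K'inl s l1 sK' l1s; rewrite lA -lA; move: (sx _ l1s); rewrite lA.
have qE (s : {set label}) l : s \in K' -> l \in s -> q (opp_label l) = Tcover_act (q l).
  by move=> sK' ls; have [A ->] := K'inl s l sK' ls.
exists (push q z'); first exact: push_inv_cycles qS qE _ _ z'K'.
by rewrite (nu_push K'free (nerve_free ZT U) qS qE) // nuz' nuz.
Qed.

End Labels.

Theorem corollary1p2 (R : realType) (m n k : nat)
  (k_ge1 : (1 <= k)%N) (m_ge1 : (1 <= m)%N) (m_le : (m <= n - k)%N)
  (f : stiefel R n k -> 'rV[R]_m) (f_cont : continuous f) :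
  let S := stiefel_inv R n k in
  let Z := [set V : stiefel R n k | f (S V) = f V] in
  exists SZ : S @` Z = Z, yang_index_ge (restr SZ) (n - k - m).
Proof.
move=> S Z; exists (coincidence_inv f).
have ZT := coincidence_Tspace k_ge1 f_cont (coincidence_inv f).
apply: (yang_index_ge_nu ZT); apply: (nu_nonzero_exists ZT) => U.
(* The truncated difference [n - k] is at least [m], hence positive. *)
have k_le : (k <= n)%N by lia.
have [e [eN e_near]] := stiefel_param R k_ge1 k_le.
exact: (nerve_cycle k_ge1 m_ge1 m_le f_cont U eN e_near).
Qed.
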